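(* Let $t\geq 2$ be an integer, $m=4t+2$, $n=2^m+1$, $a=2^{2t+2}+2^{2t+1}$, and let $\delta_1=\frac{n}{5}$, $\delta_2=2^{4t-1}+\frac{2^{4t}-1}{5}$, $\delta_3=\delta_2-6$, with $\delta_4=\delta_2-8$, $\delta_5=\delta_2-24$ if $t=2$ and $\delta_4=\delta_2-96$, $\delta_5=\delta_2-102$ if $t>2$. Let $\delta$ be an odd integer. Then: (1) $\mathcal{C}(n,2,\delta,1)$ has parameters $[n,\ n-m\delta+3m,\ d\geq\delta]$ if $2^{2t+1}+3\leq\delta\leq 2^{2t+2}-5$; $[n,\ n-m\delta+11m,\ d\geq\delta]$ if $2^{2t+2}+5\leq\delta\leq 2^{2t+2}+2^{2t}-3$; $[n,\ n-m\delta+15m,\ d\geq\delta]$ if $2^{2t+2}+2^{2t}+3\leq\delta\leq a-3$; $[n,\ n-ma+16m,\ d\geq a+5]$ if $a-1\leq\delta\leq a+5$; $[n,\ 2m(i-1)+5,\ d\geq\delta_i]$ if $\delta_{i+1}+2\leq\delta\leq\delta_i$ for some $i\in\{1,2,3,4\}$; $[n,1,n]$ if $\delta_1+2\leq\delta\leq n$. (2) $\mathcal{C}(n,2,\delta+1,0)$ has parameters $[n,\ 2^m-m\delta+3m,\ d\geq2\delta]$ if $2^{2t+1}+3\leq\delta\leq 2^{2t+2}-5$; $[n,\ 2^m-m\delta+11m,\ d\geq2\delta]$ if $2^{2t+2}+5\leq\delta\leq 2^{2t+2}+2^{2t}-3$; $[n,\ 2^m-m\delta+15m,\ d\geq2\delta]$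 if $2^{2t+2}+2^{2t}+3\leq\delta\leq a-3$; $[n,\ 2^m-ma+16m,\ d\geq2(a+5)]$ if $a-1\leq\delta\leq a+5$; $[n,\ 2m(i-1)+4,\ d\geq2\delta_i]$ if $\delta_{i+1}+2\leq\delta\leq\delta_i$ for some $i\in\{1,2,3,4\}$.
   Context: For $n=2^m+1$ and an integer $x$, the 2-cyclotomic coset of $x$ modulo $n$ is $C_x=\{x\cdot 2^{j} \bmod n : j\geq 0\}\subseteq\{0,1,\dots,n-1\}$. Let $\xi$ be a primitive $n$-th root of unity in an extension field of $\mathbb{F}_2$. A binary cyclic code of length $n$ with generator polynomial $g(x)$ has defining set $\{i\in\{0,\dots,n-1\}: g(\xi^i)=0\}$ (a union of cosets $C_x$), and its dimension is $n$ minus the size of the defining set. $\mathcal{C}(n,2,\delta,1)$ denotes the binary cyclic code of length $n$ with defining set $C_1\cup C_2\cup\cdots\cup C_{\delta-1}$, and $\mathcal{C}(n,2,\delta+1,0)$ the one with defining set $C_0\cup C_1\cup\cdots\cup C_{\delta-1}$. $[n,k,d]$ denotes a linear code of length $n$, dimension $k$, minimum Hamming distance $d$. *)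

(* Defs.v *)
From HB Require Import structures.
From mathcomp Require Import all_boot all_order all_algebra all_fingroup all_field.
Set Implicit Arguments. Unset Strict Implicit. Unset Printing Implicit Defensive.
Import GRing.Theory.
Local Open Scope ring_scope.

(* Indices 0..n-1 of a length-n code, with n = l.+1 (n = 2^m+1 below). *)

Definition dbl (l : nat) (i : 'I_l.+1) : 'I_l.+1 := inord ((2 * i) %% l.+1)%N.

Definition cyc_coset (l x : nat) : {set 'I_l.+1} :=
  [set i | fconnect (@dbl l) (inord (x %% l.+1)%N) i].

Definition defset1 (l d : nat) : {set 'I_l.+1} :=
  \bigcup_(1 <= x < d) cyc_coset l x.

(* defining set C_0 u ... u C_{d-1}  (code C(n,2,d+1,0)) *)
Definition defset0 (l d : nat) : {set 'I_l.+1} :=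
  \bigcup_(0 <= x < d) cyc_coset l x.

Definition eval_at (F : fieldExtType 'F_2) (xi : F) (l i : nat)
  (c : 'rV['F_2]_l.+1) : F :=
  \sum_(j < l.+1) c 0 j *: xi ^+ (i * j).

Definition cyclic_code (F : fieldExtType 'F_2) (xi : F) (l : nat)
  (T : {set 'I_l.+1}) : {vspace 'rV['F_2]_l.+1} :=
  (\bigcap_(i in T) lker (linfun (@eval_at F xi l i)))%VS.

Definition wt (l : nat) (c : 'rV['F_2]_l.+1) : nat := #|[set j | c 0 j != 0]|.

Definition has_params (l : nat) (C : {vspace 'rV['F_2]_l.+1}) (k d0 : nat) : Prop :=
  \dim C = k /\ (forall c, c \in C -> c != 0 -> (d0 <= wt c)%N).

Definition dlt2 (t : nat) : nat := (2 ^ (4 * t - 1) + (2 ^ (4 * t) - 1) %/ 5)%N.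
Definition dlt (t i : nat) : nat :=
  match i with
  | 1 => ((2 ^ (4 * t + 2)).+1 %/ 5)%N
  | 2 => dlt2 t
  | 3 => (dlt2 t - 6)%N
  | 4 => if t == 2%N then (dlt2 t - 8)%N else (dlt2 t - 96)%N
  | 5 => if t == 2%N then (dlt2 t - 24)%N else (dlt2 t - 102)%N
  | _ => 0%N
  end.

(* Main.v *)
From Stdlib Require Import NArith.
Require Import Defs.
From HB Require Import structures.
From mathcomp Require Import all_boot all_order all_algebra all_fingroup all_field.
From mathcomp Require Import zify.
Import GRing.Theory.

(** A code whose defining set [T] is stable under doubling has dimension
    [n - #|T|] (its generator polynomial is fixed by Frobenius), and the BCH bound
    gives the minimum distances because [2 ^ m = -1] makes every coset symmetric.
    Everything then rests on which [x] are coset leaders.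

    Small [x]: put [N = 2 ^ (2 t + 1)], so that [n = N ^ 2 + 1].  If
    [x 2 ^ j = +- y] modulo [n] with [x, y] odd below [3 N - 1] and [j <= 2 t + 1],
    then [x 2 ^ j = n +- y], so [2 ^ j] is [N] or [N / 2], and only the ten numbers
    of [bad_odd] escape.

    Large [x]: modulo sign, doubling is the tent map on [[0, n / 2]].  An orbit
    staying above about [7 n / 40] leaves the repelling fixed point [n / 3], and then
    oscillates around the 2-cycle [{n / 5, 2 n / 5}], where each double step
    multiplies [S = 5 y - n] by [-4], until it exits near [7 n / 40]; there
    [D = 40 y - 7 n] becomes [S = - 2 D] four steps later.  Since [m = 2] modulo 4,
    not every exit has [D > 0], and an exit with [D = - d < 0] forces some [4 ^ q d]
    to be close to [n = 4 ^ (2 t + 1) + 1]; this leaves [d = 15, 255, 3855], that is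
    delta_2, delta_3 and delta_4. *)

Local Open Scope nat_scope.

(** * Cyclic codes *)

Fact eval_at_is_linear (F : fieldExtType 'F_2) (xi : F) (l i : nat) :
  linear (@eval_at F xi l i).
Proof.
move=> a u v; rewrite /eval_at scaler_sumr -big_split /=.
by apply: eq_bigr => j _; rewrite !mxE scalerDl scalerA.
Qed.

HB.instance Definition _ (F : fieldExtType 'F_2) (xi : F) (l i : nat) :=
  GRing.isLinear.Build 'F_2 'rV['F_2]_l.+1 F *:%R (@eval_at F xi l i)
    (eval_at_is_linear F xi l i).

Lemma mem_cyclic_code (F : fieldExtType 'F_2) (xi : F) (l : nat)
    (T : {set 'I_l.+1}) (c : 'rV['F_2]_l.+1) :
  reflect (forall i, i \in T -> eval_at xi i c = 0)%R (c \in cyclic_code xi T).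
Proof.
rewrite memvE; apply: (iffP subv_bigcapP) => H i iT.
  by have:= H i iT; rewrite -memvE memv_ker lfunE => /eqP.
by rewrite -memvE memv_ker lfunE; apply/eqP/H.
Qed.

Lemma eval_at_poly (F : fieldExtType 'F_2) (xi : F) (l i : nat)
    (c : 'rV['F_2]_l.+1) :
  eval_at xi i c = ((map_poly (in_alg F) (rVpoly c)).[xi ^+ i])%R.
Proof.
rewrite (@horner_coef_wide _ l.+1); last first.
  by rewrite size_map_poly size_poly.
apply: eq_bigr => j _; rewrite coef_map /= coef_rVpoly_ord -exprM.
by rewrite mulr_algl.
Qed.

(** If the support [J] had fewer than [d] points, the polynomial [p] vanishing at [J] except [j0]
    would have size below [d]. Its combination of the syndromes at [b + i] is zero, yet it equals
    the single nonzero term at [j0]. This replaces the Vandermonde determinant. *)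
Lemma bch_bound (F : fieldExtType 'F_2) (xi : F) (l : nat) (T : {set 'I_l.+1})
    (b d : nat) (c : 'rV['F_2]_l.+1) :
  (l.+1).-primitive_root%R xi ->
  (forall i, (i.+1 < d)%N -> inord ((b + i) %% l.+1) \in T) ->
  c \in cyclic_code xi T -> (c != 0)%R -> (d <= wt c)%N.
Proof.
move=> xi_prim bT /mem_cyclic_code cT c0.
rewrite leqNgt; apply/negP => ltwd.
have [j0 cj0] : exists j, (c 0 j != 0)%R.
  apply/existsP; apply: contraNT c0; rewrite negb_exists => /forallP c0.
  by apply/eqP/rowP => j; rewrite mxE; apply/eqP; have:= c0 j; rewrite negbK.
pose J := [set j | (c 0 j != 0)%R].
pose p : {poly F} := (\prod_(j in J :\ j0) ('X - (xi ^+ j)%:P))%R.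
have sp : size p = #|J|.
  by rewrite /p -big_enum /= size_prod_XsubC -cardE (cardsD1 j0 J) inE cj0.
have : (\sum_(j in J) c 0 j *: (xi ^+ (b * j) * p.[xi ^+ j]) = 0 :> F)%R.
  transitivity (\sum_(i < #|J|) p`_i * eval_at xi (b + i) c)%R; last first.
    apply: big1 => i _; suff -> : eval_at xi (b + i) c = 0%R by rewrite mulr0.
    have := cT _ (bT i (leq_ltn_trans (ltn_ord i) ltwd)).
    rewrite inordK ?ltn_mod //; apply: etrans; apply: eq_bigr => j _.
    by rewrite !exprM (prim_expr_mod xi_prim).
  have -> : (\sum_(j in J) c 0 j *: (xi ^+ (b * j) * p.[xi ^+ j]) =
     \sum_(j < l.+1) c 0 j *: (xi ^+ (b * j) * p.[xi ^+ j]) :> F)%R.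
    rewrite [RHS](bigID (mem J)) /= [X in (_ + X)%R]big1 ?addr0 // => j.
    by rewrite inE negbK => /eqP ->; rewrite scale0r.
  transitivity (\sum_(i < #|J|) \sum_(j < l.+1)
      p`_i * (c 0 j *: xi ^+ ((b + i) * j)))%R; last first.
    by apply: eq_bigr => i _; rewrite mulr_sumr.
  rewrite exchange_big; apply: eq_bigr => j _ /=.
  rewrite horner_coef sp mulr_sumr scaler_sumr; apply: eq_bigr => i _.
  rewrite -scalerAr; congr (_ *: _)%R.
  by rewrite mulrCA -exprM -exprD mulnDl [(i * j)%N]mulnC.
rewrite (bigD1 j0) ?inE //= big1 ?addr0; last first.
  move=> j /andP[jJ jj0]; rewrite (_ : p.[_]%R = 0%R) ?mulr0 ?scaler0 //.
  rewrite /p horner_prod (bigD1 j) /= ?in_setD1 ?jj0 //.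
  by rewrite hornerXsubC subrr mul0r.
move/eqP; rewrite scaler_eq0 (negPf cj0) mulf_eq0 expf_eq0.
have xi0 : (xi != 0)%R by rewrite (prim_root_eq0 xi_prim).
rewrite (negPf xi0) andbF /= horner_prod => /prodf_eq0[j].
rewrite !inE hornerXsubC subr_eq0 (eq_prim_root_expr xi_prim) !modn_small //.
by case/andP=> jj0 _ /eqP/val_inj j0j; rewrite j0j eqxx in jj0.
Qed.

(** Doubling is injective for odd length, so it permutes [T] and Frobenius fixes the product; each
    coefficient then satisfies [z ^ 2 = z], hence is 0 or 1. *)
Lemma generator_poly (F : fieldExtType 'F_2) (xi : F) (l : nat)
    (T : {set 'I_l.+1}) :
  (l.+1).-primitive_root%R xi -> ~~ odd l ->
  (forall i, i \in T -> dbl i \in T) ->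
  exists g : {poly 'F_2},
    map_poly (in_alg F) g = (\prod_(i in T) ('X - (xi ^+ i)%:P))%R.
Proof.
move=> xi_prim l_even Tdbl; set p := (\prod_(i in T) _)%R.
have F2 : 2 \in [pchar F]%R by rewrite pchar_lalg pchar_Fp.
have dbl_inj : injective (@dbl l).
  have e (k : 'I_l.+1) : 2 * k %% l.+1 = if 2 * k < l.+1 then 2 * k else 2 * k - l.+1.
    have [?|?] := ltnP; first exact: modn_small.
    by rewrite -{1}[2 * k](@subnK l.+1) // modnDr modn_small //; have := ltn_ord k; lia.
  move=> i j /(congr1 val); rewrite /= !inordK ?ltn_mod // !e => ij.
  have := odd_double_half l; rewrite (negPf l_even) -mul2n => lE.
  apply: val_inj => /=; have := ltn_ord i; have := ltn_ord j.
  by move: ij; do 2 case: ifP => ?; lia.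
have dblT : [set dbl i | i in T] = T.
  apply/eqP; rewrite eqEcard card_imset // leqnn andbT.
  by apply/subsetP => _ /imsetP[i iT ->]; apply: Tdbl.
have Frob_p : map_poly (pFrobenius_aut F2) p = p.
  rewrite map_prod_XsubC [RHS](reindex_inj dbl_inj) /=.
  apply: eq_big => [i | i iT].
    by rewrite -[in RHS]dblT mem_imset.
  rewrite pFrobenius_autE -exprM /= inordK ?ltn_mod //.
  by rewrite prim_expr_mod // mulnC.
have coef_p i : (p`_i == 0)%R || (p`_i == 1)%R.
  have := congr1 (fun q : {poly F} => q`_i)%R Frob_p.
  rewrite coef_map /= pFrobenius_autE => /eqP.
  by rewrite -subr_eq0 expr2 -[X in (_ - X)%R]mulr1 -mulrBr mulf_eq0 subr_eq0.
exists (\poly_(i < size p) (p`_i != 0)%:R)%R.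
apply/polyP=> i; rewrite coef_map coef_poly.
have [ip|ip] := ltnP; last by rewrite /= scale0r nth_default.
case/orP: (coef_p i) => /eqP -> /=; first by rewrite eqxx scale0r.
by rewrite oner_eq0 scale1r.
Qed.

(** Multiplication by the generator polynomial embeds the vectors of length [k = n - #|T|]. It
    reaches the whole code because the roots [xi ^ i] are distinct, so that [g] divides every
    codeword. *)
Lemma dim_cyclic_code (F : fieldExtType 'F_2) (xi : F) (l : nat)
    (T : {set 'I_l.+1}) :
  (l.+1).-primitive_root%R xi -> ~~ odd l ->
  (forall i, i \in T -> dbl i \in T) ->
  \dim (cyclic_code xi T) = l.+1 - #|T|.
Proof.
move=> xi_prim l_even Tdbl.
have [g gE] := generator_poly _ _ _ _ xi_prim l_even Tdbl.
have size_g : size g = #|T|.+1.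
  by rewrite -(size_map_poly (in_alg F)) gE -big_enum /= size_prod_XsubC cardE.
have g0 : (g != 0)%R by rewrite -size_poly_eq0 size_g.
have leTl : #|T| <= l.+1 by rewrite -[leqRHS]card_ord max_card.
have [k kE] : exists k, k + #|T| = l.+1 by exists (l.+1 - #|T|); rewrite subnK.
pose phi (u : 'rV['F_2]_k) : 'rV['F_2]_l.+1 := poly_rV (rVpoly u * g)%R.
have phiK u : rVpoly (phi u) = (rVpoly u * g)%R.
  apply: poly_rV_K; apply: leq_trans (size_polyMleq _ _) _.
  rewrite size_g addnS /=; apply: (@leq_trans (k + #|T|)); last by rewrite kE.
  by rewrite leq_add2r; apply: size_poly.
have phi_zero u i : i \in T -> eval_at xi i (phi u) = 0%R.
  move=> iT; rewrite eval_at_poly phiK.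
  have -> : map_poly (in_alg F) (rVpoly u * g) =
    (map_poly (in_alg F) (rVpoly u) * map_poly (in_alg F) g)%R by exact: rmorphM.
  rewrite gE hornerM horner_prod.
  by rewrite [X in (_ * X)%R](bigD1 i) //= hornerXsubC subrr mul0r mulr0.
have phi_lin : linear phi.
  move=> a u v; rewrite /phi !linearP /= mulrDl -scalerAl.
  by rewrite linearP.
pose f : {linear 'rV['F_2]_k -> 'rV['F_2]_l.+1} :=
  HB.pack phi (GRing.isLinear.Build _ _ _ _ phi phi_lin).
have -> : cyclic_code xi T = limg (linfun f).
  apply/vspaceP => c; apply/mem_cyclic_code/memv_imgP => [cT | [u _ ->] i iT].
    have : (g %| rVpoly c)%R.
      rewrite -(dvdp_map (in_alg F)) gE -big_enum /=.
      rewrite -(big_map (fun i : 'I_l.+1 => xi ^+ i)%R xpredT (fun z => 'X - z%:P)%R).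
      apply: uniq_roots_dvdp; last rewrite uniq_rootsE map_inj_uniq ?enum_uniq //.
        apply/allP => _ /mapP[i iT ->]; rewrite mem_enum in iT.
        by rewrite rootE -eval_at_poly cT.
      move=> i j /eqP; rewrite (eq_prim_root_expr xi_prim) !modn_small //.
      by move/eqP/val_inj.
    case/dvdpP => q qE; exists (poly_rV q); first exact: memvf.
    rewrite lfunE /= /phi poly_rV_K ?qE -?qE ?rVpolyK //.
    have [->|q0] := eqVneq q 0%R; first by rewrite size_poly0.
    have : size (q * g)%R <= l.+1 by rewrite -qE; apply: size_poly.
    by rewrite size_mul // size_g addnS /= -[X in _ <= X]kE leq_add2r.
  by rewrite lfunE; apply: phi_zero.
rewrite limg_dim_eq ?dimvf ?dim_matrix; first by rewrite mul1r -[k](addnK #|T|) kE.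
apply/eqP; rewrite -subv0; apply/subvP => u; rewrite memv_cap memv_ker lfunE /=.
case/andP=> _ /eqP phi0; rewrite memv0; apply/eqP.
have := phiK u; rewrite phi0 linear0 => /esym/eqP.
rewrite mulf_eq0 (negPf g0) orbF => /eqP u0.
by rewrite -[u]rVpolyK u0 linear0.
Qed.

(** * Cyclotomic cosets *)

Definition conj2 (n x y : nat) : Prop := exists j, x * 2 ^ j = y %[mod n].

Lemma iter_dblE (l x j : nat) :
  iter j (@dbl l) (inord (x %% l.+1)) = inord ((x * 2 ^ j) %% l.+1).
Proof.
elim: j => [|j IH]; first by rewrite muln1.
rewrite iterS IH /dbl; congr inord; rewrite inordK ?ltn_mod //.
by rewrite modnMmr mulnCA -expnS.
Qed.

Lemma mem_cyc_coset (l x : nat) (z : 'I_l.+1) :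
  z \in cyc_coset l x <-> conj2 l.+1 x z.
Proof.
rewrite inE; split.
  move=> /iter_findex; set k := findex _ _ _ => <-; exists k.
  by rewrite iter_dblE inordK ?ltn_mod // modn_mod.
case=> j jz; suff -> : z = iter j (@dbl l) (inord (x %% l.+1)) by apply: fconnect_iter.
by rewrite iter_dblE jz modn_small // inord_val.
Qed.

Lemma mem_bigcup_nat (l a d : nat) (A : nat -> {set 'I_l.+1}) (z : 'I_l.+1) :
  z \in \bigcup_(a <= x < d) A x <-> exists x, a <= x < d /\ z \in A x.
Proof.
elim: d => [|d IH].
  by rewrite big_geq // inE; split=> // -[x []]; rewrite ltn0 andbF.
have [ad|ad] := leqP a d; last first.
  by rewrite big_geq // inE; split=> // -[x []] xd; lia.
rewrite big_nat_recr //= inE; split=> [/orP[/IH[x [xd xz]]|zd] | [x [xd xz]]].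
- by exists x; split=> //; lia.
- by exists d; rewrite ad leqnn.
have [<-|xd'] := eqVneq x d; first by rewrite xz orbT.
by apply/orP; left; apply/IH; exists x; split=> //; lia.
Qed.

Lemma mem_defset1 (l d : nat) (z : 'I_l.+1) :
  z \in defset1 l d <-> exists x, 0 < x < d /\ conj2 l.+1 x z.
Proof.
split=> [/mem_bigcup_nat | ] [x [xd /mem_cyc_coset xz]].
  by exists x; split=> //; apply/mem_cyc_coset.
by apply/mem_bigcup_nat; exists x.
Qed.

Lemma mem_defset0 (l d : nat) (z : 'I_l.+1) :
  z \in defset0 l d <-> exists x, x < d /\ conj2 l.+1 x z.
Proof.
split=> [/mem_bigcup_nat | ] [x [xd /mem_cyc_coset xz]].
  by exists x; split=> //; apply/mem_cyc_coset.
by apply/mem_bigcup_nat; exists x.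
Qed.

Lemma conj2_refl (n x : nat) : conj2 n x x.
Proof. by exists 0; rewrite muln1. Qed.

Lemma conj2_trans (n y x z : nat) : conj2 n x y -> conj2 n y z -> conj2 n x z.
Proof.
case=> i xy [j yz]; exists (i + j).
by rewrite expnD mulnA -modnMml xy modnMml.
Qed.

Lemma pow2_mod (m j : nat) : 2 ^ (m * 2 * j) = 1 %[mod (2 ^ m).+1].
Proof.
suff h : 2 ^ (m * 2) = 1 %[mod (2 ^ m).+1].
  by rewrite expnM -modnXm h modnXm exp1n.
rewrite expnM; apply/eqP; rewrite eqn_mod_dvd ?expn_gt0 //.
by rewrite (subn_sqr _ 1) addn1 dvdn_mull.
Qed.

Lemma pow2_cancel (m x y i : nat) : 0 < m ->
  x * 2 ^ i = y * 2 ^ i %[mod (2 ^ m).+1] -> x = y %[mod (2 ^ m).+1].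
Proof.
move=> m0 h.
have aux z : z * 2 ^ i * 2 ^ (m * 2 * i - i) = z %[mod (2 ^ m).+1].
  rewrite -mulnA -expnD subnKC; last by rewrite leq_pmull // muln_gt0 m0.
  by rewrite -modnMmr pow2_mod modnMmr muln1.
by rewrite -aux -modnMml h modnMml aux.
Qed.

Lemma conj2_sym (m x y : nat) : 0 < m ->
  conj2 (2 ^ m).+1 x y -> conj2 (2 ^ m).+1 y x.
Proof.
(* The order of 2 divides [2 * m], so this power of 2 inverts [2 ^ j]. *)
move=> m0 [j xy]; exists (m * 2 * j - j).
rewrite -modnMml -xy modnMml -mulnA -expnD.
rewrite subnKC; last by rewrite leq_pmull // muln_gt0 m0.
by rewrite -modnMmr pow2_mod modnMmr muln1.
Qed.

(* Doubling [m] times is negation, because 2 ^ m = -1 modulo n. *)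
Lemma conj2_neg (m x y j : nat) :
  (2 ^ m).+1 %| x * 2 ^ j + y -> conj2 (2 ^ m).+1 x y.
Proof.
move=> h; exists (j + m); apply/eqP.
rewrite -(eqn_modDr (x * 2 ^ j)).
have -> : x * 2 ^ (j + m) + x * 2 ^ j = x * 2 ^ j * (2 ^ m).+1.
  by rewrite expnD mulnA mulnS addnC.
by rewrite modnMl addnC eq_sym.
Qed.

Lemma conj2_pos (n x y j q : nat) : x * 2 ^ j = y + q * n -> conj2 n x y.
Proof. by move=> h; exists j; rewrite h addnC modnMDl. Qed.

(** Exponents matter only modulo [2 * m], and [2 ^ m = -1] brings them below [m] at the price of a
    sign. *)
Lemma conj2P (m x y : nat) : 0 < m -> conj2 (2 ^ m).+1 x y ->
  exists2 j, j < m &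
    x * 2 ^ j = y %[mod (2 ^ m).+1] \/ (2 ^ m).+1 %| x * 2 ^ j + y.
Proof.
move=> m0 [k]; have m20 : 0 < m * 2 by rewrite muln_gt0 m0.
have -> : x * 2 ^ k = x * 2 ^ (k %% (m * 2)) %[mod (2 ^ m).+1].
  rewrite {1}(divn_eq k (m * 2)) expnD [k %/ _ * _]mulnC.
  by rewrite mulnCA -modnMml pow2_mod modnMml mul1n.
set j := k %% _ => xy.
have [jm|mj] := ltnP j m; first by exists j => //; left.
exists (j - m); first by have := ltn_pmod k m20; rewrite -/j; lia.
right; move: xy; rewrite -{1}(subnK mj) expnD mulnA => xy.
by rewrite /dvdn -modnDmr -xy modnDmr -mulnS modnMl.
Qed.

Lemma card_cyc_coset (m x k : nat) : 0 < m -> 0 < k ->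
  x * 2 ^ k = x %[mod (2 ^ m).+1] ->
  (forall j, 0 < j < k -> x * 2 ^ j <> x %[mod (2 ^ m).+1]) ->
  #|cyc_coset (2 ^ m) x| = k.
Proof.
move=> m0 k0 xk kmin.
pose f (j : 'I_k) : 'I_(2 ^ m).+1 := inord ((x * 2 ^ j) %% (2 ^ m).+1).
have -> : cyc_coset (2 ^ m) x = [set f j | j : 'I_k].
  apply/setP=> z; apply/idP/imsetP.
    move=> /mem_cyc_coset[j xz]; exists (Ordinal (ltn_pmod j k0)) => //.
    apply: val_inj; rewrite /= inordK ?ltn_mod //=.
    rewrite -[LHS](@modn_small _ (2 ^ m).+1) // -xz {1}(divn_eq j k).
    elim: (j %/ k) => [|i IH]; first by rewrite mul0n.
    by rewrite mulSn -addnA expnD mulnA -modnMml xk modnMml.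
  move=> [j _ ->]; apply/mem_cyc_coset; exists j.
  by rewrite inordK ?ltn_mod // modn_mod.
rewrite card_imset ?card_ord //.
have aux (i j : 'I_k) : i < j -> f i <> f j.
  move=> ij /(congr1 val); rewrite /= !inordK ?ltn_mod //.
  rewrite -(subnK (ltnW ij)) expnD mulnA => /esym /(pow2_cancel _ _ _ _ m0).
  by apply: kmin; rewrite subn_gt0 ij (leq_ltn_trans (leq_subr _ _)).
move=> i j fij; apply: val_inj.
by case: (ltngtP i j) => // /aux; [case | case; rewrite fij].
Qed.

(** * Small coset leaders *)

(* The odd numbers below [6 H + 4] that are not coset leaders modulo
   [n = 4 * H ^ 2 + 1]. *)
Definition bad_odd (H : nat) : seq nat :=
  [:: 2 * H + 1; 4 * H - 3; 4 * H - 1; 4 * H + 1; 4 * H + 3; 5 * H - 1; 5 * H + 1;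
      6 * H - 1; 6 * H + 1; 6 * H + 3].

Lemma odd2 x : odd x -> exists k, x = 2 * k + 1.
Proof. by move=> ox; exists x./2; rewrite -[LHS]odd_double_half ox; lia. Qed.

Lemma odd_leader_uniq (s H x y j : nat) : 2 * H = 2 ^ s -> 16 <= H ->
  odd x -> odd y -> x < 6 * H - 1 -> y < 6 * H - 1 ->
  x \notin bad_odd H -> y \notin bad_odd H -> j <= s ->
  (4 * H ^ 2 + 1 %| x * 2 ^ j + y \/ x * 2 ^ j = y %[mod 4 * H ^ 2 + 1]) ->
  j = 0 /\ x = y.
Proof.
move=> HE H16 ox oy xH yH xbad ybad js.
rewrite -mulnn.
have X k : k \in bad_odd H -> x = k -> False.
  by move=> kb xk; rewrite xk kb in xbad.
have Y k : k \in bad_odd H -> y = k -> False.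
  by move=> kb yk; rewrite yk kb in ybad.
move: xbad ybad => _ _.
have [kx xE] := odd2 x ox; have [ky yE] := odd2 y oy.
have x6 : x <= 6 * H - 3 by lia.
have HH : 16 * H <= H * H by rewrite leq_mul2r H16 orbT.
have [p pE] : exists p, 2 * H = 2 ^ j * 2 ^ p.
  by exists (s - j); rewrite -expnD subnKC.
have xj : x * 2 ^ j * 2 ^ p = x * (2 * H) by rewrite pE mulnA.
have xb : x * (2 * H) <= (6 * H - 3) * (2 * H) by rewrite leq_mul.
have p0 : 0 < 2 ^ p by rewrite expn_gt0.
have xjb : x * 2 ^ j <= (6 * H - 3) * (2 * H).
  by apply: leq_trans xb; rewrite -xj leq_pmulr.
have bE : (6 * H - 3) * (2 * H) + 6 * H = 12 * (H * H).
  by rewrite mulnBl; lia.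
set n := 4 * (H * H) + 1 => h.
have [q qE] : exists q, x * 2 ^ j + y = q * n \/ x * 2 ^ j = y + q * n.
  case: h => [/dvdnP[q ->]|h]; first by exists q; left.
  have [xy|yx] := ltnP (x * 2 ^ j) y.
    have yn : y < n by rewrite /n; lia.
    move: h; rewrite !modn_small // ?(ltn_trans xy) // => h.
    by rewrite h ltnn in xy.
  have /dvdnP[q qE] : n %| x * 2 ^ j - y by rewrite -eqn_mod_dvd ?h.
  by exists q; right; rewrite -qE subnKC.
have {h} nE : n = 4 * (H * H) + 1 by [].
(* Both [x * 2 ^ j] and [x * 2 ^ j + y] are below [12 * H ^ 2], hence below [3 * n]. *)
have q2 : q <= 2.
  rewrite leqNgt; apply/negP => /(leq_mul (leqnn n)).
  by move: qE; rewrite [n * q]mulnC; set nq := q * n; lia.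
case: j => [|j] in js pE xj xjb qE *.
  rewrite expn0 muln1 in qE; split => //.
  by case: q q2 qE => [|[|[|]]] // _; lia.
rewrite expnS in qE xj xjb pE.
(* Now [2 ^ j] is even while [y] and [n] are odd, so [q] is odd. *)
have {q2} q1 : q = 1.
  by case: q q2 qE => [|[|[|]]] // _; lia.
exfalso; move: qE; rewrite {}q1 mul1n {}nE => qE {n}.
(* The power of 2 is [2 * H], [H], or at most [H / 2]. In the first two cases [x] differs from
   [2 * H] or [4 * H] by an odd number [2 * c + 1]: a small [c] makes [x] or [y] bad, a larger one
   makes [y] too big. In the last case the product cannot reach [n - y]. *)
case: p p0 pE xj => [|[|p]] _ pE xj.
- rewrite muln1 in xj; rewrite xj in qE.
  have [Hx|Hx] := leqP (2 * H) x.
    have [c cE] : exists c, x = 2 * H + (2 * c + 1) by exists (kx - H); lia.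
    move: qE; rewrite cE mulnDl; case: c cE => [|c] cE.
      by move=> *; apply: (X (2 * H + 1)); [rewrite !inE eqxx ?orbT | lia].
    have := leq_mul (leqnn (2 * H)) (leq_addl (2 * c) 3).
    rewrite [(2 * H) * (_ + 3)]mulnC (_ : 2 * c + 3 = 2 * c.+1 + 1); last by lia.
    by move: yH H16; set w := _ * (2 * H); set w' := H * H; lia.
  have [c cE] : exists c, x + (2 * c + 1) = 2 * H by exists (H - kx - 1); lia.
  have : x * (2 * H) + (2 * c + 1) * (2 * H) = 4 * (H * H) by rewrite -mulnDl cE; lia.
  case: c cE => [|c] cE.
    move=> *; apply: (Y (2 * H + 1)); [by rewrite !inE eqxx ?orbT |].
    by move: qE; set w := x * (2 * H); lia.
  have := leq_mul (leqnn (2 * H)) (leq_addl (2 * c) 3).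
  rewrite [(2 * H) * (_ + 3)]mulnC (_ : 2 * c + 3 = 2 * c.+1 + 1); last by lia.
  by move: qE yH H16; set w := _ * (2 * H); set w1 := _ * (2 * H); lia.
- have {}xj : x * (2 * 2 ^ j) = x * H by move: xj; rewrite expn1; lia.
  rewrite xj in qE.
  have [Hx|Hx] := leqP (4 * H) x.
    have [c cE] : exists c, x = 4 * H + (2 * c + 1) by exists (kx - 2 * H); lia.
    move: qE; rewrite cE mulnDl; case: c cE => [|[|[|c]]] cE.
    - by move=> *; apply: (X (4 * H + 1)); [rewrite !inE eqxx ?orbT | lia].
    - by move=> *; apply: (X (4 * H + 3)); [rewrite !inE eqxx ?orbT | lia].
    - by move=> *; apply: (Y (5 * H - 1)); [rewrite !inE eqxx ?orbT | lia].
    have := leq_mul (leqnn H) (leq_addl (2 * c) 7).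
    rewrite [H * (_ + 7)]mulnC (_ : 2 * c + 7 = 2 * c.+3 + 1); last by lia.
    by move: yH H16; set w := _ * H; set w' := H * H; lia.
  have [c cE] : exists c, x + (2 * c + 1) = 4 * H by exists (2 * H - kx - 1); lia.
  have : x * H + (2 * c + 1) * H = 4 * (H * H) by rewrite -mulnDl cE; lia.
  case: c cE => [|[|[|c]]] cE.
  - by move=> *; apply: (X (4 * H - 1)); [rewrite !inE eqxx ?orbT | lia].
  - by move=> *; apply: (X (4 * H - 3)); [rewrite !inE eqxx ?orbT | lia].
  - move=> *; apply: (Y (5 * H + 1)); [by rewrite !inE eqxx ?orbT |].
    by move: qE; set w := x * H; lia.
  have := leq_mul (leqnn H) (leq_addl (2 * c) 7).
  rewrite [H * (_ + 7)]mulnC (_ : 2 * c + 7 = 2 * c.+3 + 1); last by lia.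
  by move: qE yH H16; set w := _ * H; set w1 := _ * H; lia.
have p4 : 4 <= 2 ^ p.+2 by rewrite !expnS !mulnA leq_pmulr // expn_gt0.
have := leq_mul (leqnn (x * (2 * 2 ^ j))) p4; rewrite xj.
by move: qE xb bE HH H16 yH; clear; set w := x * _; nia.
Qed.

(** Multiplying by [2 ^ (m - j)] turns [2 ^ j] into -1, which exchanges [x] and [y] and flips the
    sign. Exponents above [m / 2] thus reduce to those below. *)
Lemma conj2_flip (m x y j : nat) : j <= m ->
  (x * 2 ^ j = y %[mod (2 ^ m).+1] -> (2 ^ m).+1 %| y * 2 ^ (m - j) + x) /\
  ((2 ^ m).+1 %| x * 2 ^ j + y -> y * 2 ^ (m - j) = x %[mod (2 ^ m).+1]).
Proof.
move=> jm.
have e : x * 2 ^ j * 2 ^ (m - j) + x = x * (2 ^ m).+1.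
  by rewrite -mulnA -expnD subnKC // mulnS addnC.
split=> h.
  by rewrite /dvdn -modnDml -modnMml -h modnMml modnDml e modnMl.
apply/eqP; rewrite -(eqn_modDl (x * 2 ^ j * 2 ^ (m - j))) -mulnDl e modnMl.
by rewrite -/(dvdn _ _) dvdn_mulr.
Qed.

Lemma card_cyc_coset_full (m x : nat) : 0 < m -> 0 < x < (2 ^ m).+1 ->
  (forall j, 0 < j < m -> x * 2 ^ j <> x %[mod (2 ^ m).+1] /\
     ~~ ((2 ^ m).+1 %| x * 2 ^ j + x)) ->
  #|cyc_coset (2 ^ m) x| = 2 * m.
Proof.
move=> m0 /andP[x0 xn] xmin; apply: card_cyc_coset => //; first by rewrite muln_gt0.
  by rewrite -modnMmr [2 * m]mulnC -[m * 2]muln1 pow2_mod modnMmr muln1.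
move=> j /andP[j0 j2]; have [jm|mj] := ltnP j m.
  by case: (xmin j _) => //; rewrite j0.
move=> h; have xx : (2 ^ m).+1 %| x * 2 ^ (j - m) + x.
  have e : x * 2 ^ j = x * 2 ^ (j - m) * 2 ^ m by rewrite -mulnA -expnD subnK.
  by rewrite /dvdn -modnDmr -h modnDmr e -mulnS modnMl.
(* For [j = m] the congruence reads [- x = x], impossible since [n] is odd and [0 < x < n]. *)
have [jm|mj'] := eqVneq j m.
  move: xx; rewrite jm subnn muln1 addnn -muln2 Gauss_dvdl ?gtnNdvd //.
  by rewrite coprimen2 /= oddX /= orbF -lt0n.
case: (xmin (j - m) _) => [|_ /negP]; last by apply.
by move: mj mj' j2; lia.
Qed.

Definition is_good (H x : nat) : bool := odd x && (x \notin bad_odd H).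

(** [odd_leader_uniq] covers [j <= s]; for larger [j] the flip applies it to [2 * s - j], which
    would have to be 0. *)
Lemma good_conj2 (s H x y j : nat) : 2 * H = 2 ^ s -> 16 <= H ->
  is_good H x -> is_good H y -> x < 6 * H - 1 -> y < 6 * H - 1 -> j < 2 * s ->
  x * 2 ^ j = y %[mod (2 ^ (2 * s)).+1] \/ (2 ^ (2 * s)).+1 %| x * 2 ^ j + y ->
  j = 0 /\ x = y.
Proof.
move=> HE H16 /andP[ox xb] /andP[oy yb] xH yH js.
have nE : (2 ^ (2 * s)).+1 = 4 * H ^ 2 + 1.
  by rewrite mulnC expnM -HE expnMn addn1.
have [js'|js'] := leqP j s.
  rewrite nE => h; apply: (odd_leader_uniq s H x y j) => //.
  by case: h => h; [right | left].
have [f1 f2] := conj2_flip (2 * s) x y j (ltnW js).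
move=> h.
have [jz _] : 2 * s - j = 0 /\ y = x; last by exfalso; move: jz js; clear; lia.
apply: (odd_leader_uniq s H y x (2 * s - j)) => //; first by move: js'; clear; lia.
by rewrite -nE; case: h => h; [left; apply: f1 | right; apply: f2].
Qed.

Lemma card_good_coset (s H x : nat) : 2 * H = 2 ^ s -> 16 <= H ->
  is_good H x -> x < 6 * H - 1 -> #|cyc_coset (2 ^ (2 * s)) x| = 4 * s.
Proof.
move=> HE H16 gx xH.
have s0 : 0 < s by case: (s) HE => //; rewrite expn0; lia.
have HH : 16 * H <= H ^ 2 by rewrite -mulnn leq_mul2r H16 orbT.
have -> : 4 * s = 2 * (2 * s) by rewrite mulnA.
apply: card_cyc_coset_full; rewrite ?muln_gt0 //.
  rewrite odd_gt0; last by case/andP: gx.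
  by rewrite mulnC expnM -HE expnMn; move: xH HH; clear; lia.
move=> j /andP[j0 js]; split; last apply/negP; move=> h.
  have [j00 _] := good_conj2 s H x x j HE H16 gx gx xH xH js (or_introl h).
  by rewrite j00 in j0.
have [j00 _] := good_conj2 s H x x j HE H16 gx gx xH xH js (or_intror h).
by rewrite j00 in j0.
Qed.

(** Each bad number, multiplied by [H], [2 * H] or [4 * H], becomes a smaller number up to sign. The
    arguments of [hneg] and [hpos] are the exponent, that smaller number, the quotient by [n] and
    the power of 2. *)
Lemma bad_conj2 (s H x : nat) : 2 * H = 2 ^ s -> 16 <= H -> x \in bad_odd H ->
  exists2 y, 0 < y < x & conj2 (2 ^ (2 * s)).+1 x y.
Proof.
move=> HE H16.
have s2 : 1 < s by case: (s) HE => [|[|]] //; rewrite ?expn0 ?expn1; lia.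
have nE : (2 ^ (2 * s)).+1 = 4 * (H * H) + 1.
  by rewrite mulnC expnM -HE expnMn addn1 -mulnn.
have HE1 : H = 2 ^ s.-1.
  case: s HE s2 {nE} => // s; rewrite expnS /= => HE _.
  by apply/eqP; rewrite -(eqn_pmul2l (isT : 0 < 2)) HE.
have HE2 : 4 * H = 2 ^ s.+1 by rewrite expnS -HE mulnA.
have hneg j y q p : y > 0 -> y < x -> p = 2 ^ j ->
    x * p + y = q * (4 * (H * H) + 1) ->
    exists2 y, 0 < y < x & conj2 (2 ^ (2 * s)).+1 x y.
  move=> y0 yx -> xq; exists y; first by rewrite y0.
  by apply: (conj2_neg _ _ _ j); rewrite nE xq dvdn_mull.
have hpos j y q p : y > 0 -> y < x -> p = 2 ^ j ->
    x * p = y + q * (4 * (H * H) + 1) ->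
    exists2 y, 0 < y < x & conj2 (2 ^ (2 * s)).+1 x y.
  move=> y0 yx -> xq; exists y; first by rewrite y0.
  by apply: (conj2_pos _ _ _ j q); rewrite nE.
rewrite !inE.
have sub (a b : nat) : b <= a -> x == a - b -> x + b = a by lia.
have mulx p : forall a b, x + b = a -> x * p + b * p = a * p.
  by move=> a b <-; rewrite mulnDl.
case/or4P=> [/eqP xE|/sub xE|/sub xE|].
- by apply: (hpos s (2 * H - 1) 1 (2 * H)); rewrite ?xE //; lia.
- have {}xE : x + 3 = 4 * H by apply: xE; lia.
  have := mulx H _ _ xE; rewrite -[4 * H * H]mulnA => xH.
  by apply: (hneg s.-1 (3 * H + 1) 1 H) => //; lia.
- have {}xE : x + 1 = 4 * H by apply: xE; lia.
  have := mulx H _ _ xE; rewrite -[4 * H * H]mulnA => xH.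
  by apply: (hneg s.-1 (H + 1) 1 H) => //; lia.
case/or4P=> [/eqP xE|/eqP xE|/sub xE|].
- by apply: (hpos s.-1 (H - 1) 1 H) => //; rewrite ?xE; lia.
- by apply: (hpos s.-1 (3 * H - 1) 1 H) => //; rewrite ?xE; lia.
- have {}xE : x + 1 = 5 * H by apply: xE; lia.
  have := mulx (4 * H) _ _ xE => xH.
  by apply: (hneg s.+1 (4 * H + 5) 5 (4 * H)) => //; lia.
case/or4P=> [/eqP xE|/sub xE|/eqP xE|/eqP xE].
- by apply: (hpos s.+1 (4 * H - 5) 5 (4 * H)) => //; rewrite ?xE; lia.
- have {}xE : x + 1 = 6 * H by apply: xE; lia.
  have := mulx (2 * H) _ _ xE => xH.
  by apply: (hneg s (2 * H + 3) 3 (2 * H)) => //; lia.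
- by apply: (hpos s (2 * H - 3) 3 (2 * H)) => //; rewrite ?xE; lia.
by apply: (hpos s (6 * H - 3) 3 (2 * H)) => //; rewrite ?xE; lia.
Qed.

Lemma even_conj2 (n x : nat) : 0 < x -> ~~ odd x ->
  exists2 y, 0 < y < x & conj2 n y x.
Proof.
move=> x0 ex; have xE := odd_double_half x; rewrite (negPf ex) -mul2n in xE.
by exists x./2; [lia | exists 1; rewrite expn1 mulnC -[in RHS]xE].
Qed.

Lemma nongood_conj2 (s H x : nat) : 2 * H = 2 ^ s -> 16 <= H -> 0 < x ->
  ~~ is_good H x -> exists2 y, 0 < y < x & conj2 (2 ^ (2 * s)).+1 y x.
Proof.
move=> HE H16 x0; rewrite negb_and negbK => /orP[|] h; first exact: even_conj2.
have [y yx xy] := bad_conj2 s H x HE H16 h; exists y => //.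
apply: conj2_sym => //; rewrite muln_gt0 /=.
by case: (s) HE => //; rewrite expn0; lia.
Qed.

(** Descent on [y]: if [y] is not good, a smaller conjugate replaces it, until [good_conj2]
    applies. *)
Lemma good_not_conj2 (s H x y : nat) : 2 * H = 2 ^ s -> 16 <= H ->
  is_good H x -> x < 6 * H - 1 -> 0 < y < x -> ~ conj2 (2 ^ (2 * s)).+1 y x.
Proof.
move=> HE H16 gx xH; elim/ltn_ind: y => y IH /andP[y0 yx] yxc.
have m0 : 0 < 2 * s.
  by rewrite muln_gt0 /=; case: (s) HE => //; rewrite expn0; lia.
have [gy|gy] := boolP (is_good H y).
  have [j js h] := conj2P _ _ _ m0 yxc.
  have [|_ yx'] := good_conj2 s H y x j HE H16 gy gx _ xH js h; first lia.
  by rewrite yx' ltnn in yx.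
have [z zy zyc] := nongood_conj2 s H y HE H16 y0 gy.
case: (IH z) => //; first by case/andP: zy.
  by move: zy yx; lia.
exact: conj2_trans zyc yxc.
Qed.

Lemma defset1S (l d : nat) : 0 < d ->
  defset1 l d.+1 = defset1 l d :|: cyc_coset l d.
Proof. by move=> d0; rewrite /defset1 big_nat_recr. Qed.

(** A good number adds a new coset of full size [4 * s]; any other number lies in an earlier coset
    and adds nothing. *)
Lemma card_defset1 (s H d : nat) : 2 * H = 2 ^ s -> 16 <= H ->
  d <= 6 * H + 5 ->
  #|defset1 (2 ^ (2 * s)) d| =
    4 * s * (\sum_(0 <= x < d) is_good H x).
Proof.
move=> HE H16; elim: d => [|d IH] dH.
  by rewrite /defset1 !big_geq // cards0 muln0.
have [->|d0] := posnP d.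
  by rewrite /defset1 big_geq // big_nat1 cards0 muln0.
rewrite defset1S // big_nat_recr //= mulnDr -IH; last by lia.
have m0 : 0 < 2 * s.
  by rewrite muln_gt0 /=; case: (s) HE => //; rewrite expn0; lia.
have [gd|gd] := boolP (is_good H d); last first.
  rewrite muln0 addn0; congr #|pred_of_set _|; apply/setUidPl/subsetP=> z.
  have [y /andP[y0 yd] yc] := nongood_conj2 s H d HE H16 d0 gd.
  move/mem_cyc_coset => dz; apply/mem_defset1; exists y.
  by rewrite y0 yd; split=> //; apply: conj2_trans yc dz.
(* The odd numbers from [6 * H - 1] to [6 * H + 4] are exactly the last three bad ones; this is
   where the bound [6 * H + 5] comes from. *)
have d6 : d < 6 * H - 1.
  rewrite ltnNge; apply/negP => hd; case/andP: gd => od.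
  have [k kE] := odd2 d od.
  rewrite !inE !negb_or; lia.
rewrite cardsU (_ : _ :&: _ = set0) ?cards0 ?subn0; last first.
  apply/setP=> z; rewrite !inE; apply/negP => /andP[/mem_defset1[y [yd yz]]].
  move=> dz; case: (good_not_conj2 s H d y HE H16 gd d6 yd).
  apply: conj2_trans yz _; apply: conj2_sym => //.
  by apply/mem_cyc_coset; rewrite inE.
by rewrite (card_good_coset s H) // muln1.
Qed.

Lemma sum_odd_notin (r : seq nat) (d : nat) : uniq r -> all odd r ->
  \sum_(0 <= x < d) (odd x && (x \notin r)) + count (fun x => x < d) r = d./2.
Proof.
move=> ur or; elim: d => [|d IH].
  by rewrite big_geq //; elim: (r) => //.
rewrite big_nat_recr //=.
have -> : count (fun x => x < d.+1) r = count (fun x => x < d) r + (d \in r).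
  rewrite -count_uniq_mem // -[RHS]count_predUI.
  rewrite (@eq_count _ (predI _ _) pred0) ?count_pred0 ?addn0; last first.
    by move=> x /=; apply/negP => /andP[xd /eqP xe]; rewrite xe ltnn in xd.
  by apply: eq_count => x /=; rewrite ltnS leq_eqVlt orbC.
rewrite uphalf_half -IH.
have [dr|dr] := boolP (d \in r); last by rewrite andbT addn0 addnAC addnC.
by rewrite (allP or d dr) /= addn0 addnA addnC.
Qed.

(** * The tent map *)

(** For [y] in [[0, n / 2]], this is the representative in the same interval of [2 * y] up to sign
    modulo [n]. *)
Definition tent (n y : nat) : nat := if 4 * y <= n then 2 * y else n - 2 * y.

Lemma tent_half (n y : nat) : 2 * y <= n -> 2 * tent n y <= n.
Proof. by rewrite /tent; case: ifP; lia. Qed.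

Lemma iter_tent_half (n y j : nat) : 2 * y <= n -> 2 * iter j (tent n) y <= n.
Proof. by move=> yn; elim: j => [|j IH] //; apply: tent_half. Qed.

Lemma iter_tent_mod (n y j : nat) : 2 * y <= n ->
  iter j (tent n) y = y * 2 ^ j %[mod n] \/ n %| iter j (tent n) y + y * 2 ^ j.
Proof.
move=> yn; elim: j => [|j IH]; first by rewrite muln1; left.
have := iter_tent_half n y j yn; rewrite iterS; set w := iter _ _ _ in IH * => wn.
rewrite expnS mulnCA /tent; case: ifP => _.
  case: IH => h; [left | right]; first by rewrite -modnMmr h modnMmr.
  by rewrite -mulnDr dvdn_mull.
case: IH => h; [right | left].
  rewrite /dvdn -modnDmr -modnMmr -h modnMmr modnDmr subnK // modnn //.
apply/eqP; rewrite -(eqn_modDr (2 * w)) subnK // modnn eq_sym -mulnDr addnC.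
exact: dvdn_mull.
Qed.

(** As [2 ^ m = -1], the iterate is [y] up to sign modulo [n], and [[0, n / 2]] has one
    representative for each such pair. *)
Lemma tent_period (m y : nat) : 2 * y <= (2 ^ m).+1 ->
  iter m (tent (2 ^ m).+1) y = y.
Proof.
move=> yn; have [->//|m0] := posnP m.
have := iter_tent_half _ _ m yn; have := iter_tent_mod _ _ m yn.
set w := iter _ _ _ => h wn.
have yy : (2 ^ m).+1 %| y * 2 ^ m + y by rewrite addnC -mulnS dvdn_mull.
have n0 : y < (2 ^ m).+1 by lia.
have w0 : w < (2 ^ m).+1 by lia.
have odd_n : ~~ odd (2 ^ m) by rewrite oddX /= orbF -lt0n.
case: h => h.
  have : (2 ^ m).+1 %| w + y.
    rewrite /dvdn -modnDml h modnDml; exact: yy.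
  case/dvdnP => q qE; have : q < 2 by move: qE; nia.
  have := odd_double_half (2 ^ m); rewrite (negPf odd_n) -mul2n => e.
  by case: q qE => [|[|q]] //; lia.
have : w = y %[mod (2 ^ m).+1].
  apply/eqP; rewrite -(eqn_modDr (y * 2 ^ m)) (eqP h) addnC.
  by rewrite (eqP yy).
by rewrite !modn_small.
Qed.


(** * Closed orbits that never go below their starting point *)

Lemma tent_loop (n k y : nat) (P : nat -> Prop) :
  0 < k -> iter k (tent n) y = y -> (forall i, i < k -> P (iter i (tent n) y)) ->
  forall i, P (iter i (tent n) y).
Proof.
move=> k0 yk Pk i; rewrite (divn_eq i k) addnC iterD.
suff -> : iter (i %/ k * k) (tent n) y = y by apply/Pk/ltn_pmod.
by elim: (i %/ k) => // q IH; rewrite mulSn iterD IH.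
Qed.

(** The bound excludes the endpoint [y], so that paths concatenate; [0 < k] makes a path from [d] to
    [d] a genuine period. *)
Definition path_ge (n d x y : nat) : Prop :=
  exists2 k, 0 < k /\ iter k (tent n) x = y & forall i, i < k -> d <= iter i (tent n) x.

Lemma path_ge_trans (n d y x z : nat) :
  path_ge n d x y -> path_ge n d y z -> path_ge n d x z.
Proof.
case=> k [k0 <-] xk [j [j0 <-] yj].
exists (j + k); first by rewrite iterD addn_gt0 j0.
move=> i; have [ik|ki] := ltnP i k; first by move=> _; apply: xk.
by move=> ijk; rewrite -(subnK ki) iterD yj // ltn_subLR // addnC.
Qed.

Lemma path_ge_step (n d x : nat) : d <= x -> path_ge n d x (tent n x).
Proof. by move=> dx; exists 1 => // -[]. Qed.

(** Two steps around the 2-cycle: [S = 5 * x - n] becomes [-4 * S]. *)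
Lemma path_ge_stay (n d x : nat) : d <= x -> 7 * n <= 40 * x -> 4 * x <= n ->
  path_ge n d x (n - 4 * x).
Proof.
move=> dx h1 h2.
apply: (path_ge_trans _ _ (2 * x)).
  have -> : 2 * x = tent n x by rewrite /tent h2.
  exact: path_ge_step.
have -> : n - 4 * x = tent n (2 * x) by rewrite /tent; case: ifP; lia.
by apply: path_ge_step; lia.
Qed.

(** Four steps [x], [2 * x], [n - 4 * x], [8 * x - n], [3 * n - 16 * x]: the deviation
    [D = 40 * x - 7 * n] becomes [S = -2 * D]. *)
Lemma path_ge_exit (n d x : nat) : d <= x -> 40 * d <= 7 * n ->
  43 * n <= 256 * x -> 48 * x <= 9 * n -> path_ge n d x (3 * n - 16 * x).
Proof.
move=> dx dn h1 h2.
apply: (path_ge_trans _ _ (2 * x)).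
  have -> : 2 * x = tent n x by rewrite /tent; case: ifP; lia.
  exact: path_ge_step.
apply: (path_ge_trans _ _ (n - 4 * x)).
  have -> : n - 4 * x = tent n (2 * x) by rewrite /tent; case: ifP; lia.
  by apply: path_ge_step; lia.
apply: (path_ge_trans _ _ (8 * x - n)).
  have -> : 8 * x - n = tent n (n - 4 * x) by rewrite /tent; case: ifP; lia.
  by apply: path_ge_step; lia.
have -> : 3 * n - 16 * x = tent n (8 * x - n) by rewrite /tent; case: ifP; lia.
by apply: path_ge_step; lia.
Qed.

(** Two stays multiply [S] by 16. The bound on [s * 16 ^ k] keeps the intermediate points, where [S]
    is negative, above [7 * n / 40]. *)
Lemma path_ge_stays (n d z x s k : nat) : d <= x -> 40 * d <= 7 * n ->
  5 * x = n + s -> 32 * s * 16 ^ k <= n -> path_ge n d z x ->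
  exists2 y, path_ge n d z y & 5 * y = n + s * 16 ^ k.
Proof.
move=> dx dn xs sk zx; elim: k sk => [|k IH]; rewrite ?expn0 ?expnS => sk.
  by exists x; rewrite ?muln1.
case: IH => [|y zy ys]; first by nia.
rewrite mulnCA in sk; set q := s * 16 ^ k in ys *.
have {}sk : 512 * q <= n by rewrite /q; move: sk; lia.
exists (n - 4 * (n - 4 * y)); last by rewrite mulnCA -/q; lia.
apply: (path_ge_trans _ _ _ _ _ zy); apply: (path_ge_trans _ _ (n - 4 * y)).
  by apply: path_ge_stay; lia.
by apply: path_ge_stay; lia.
Qed.

Lemma path_ge_loop (n d : nat) :
  path_ge n d d d -> forall i, d <= iter i (tent n) d.
Proof. by case=> k [k0 dk] kge; apply: (tent_loop n k d (leq d)). Qed.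

(* The orbit of [d] when [40 d = 7 n - c]: an exit, the stays doubling
   [|5 y - n|], and the exits leading back to [d]. *)
Lemma leader2 (t n d : nat) : n = 4 ^ (2 * t + 5) + 1 -> 40 * d + 15 = 7 * n ->
  path_ge n d d d.
Proof.
move=> nE dE.
have nQ : n = 1024 * 16 ^ t + 1 by rewrite nE expnD expnM mulnC.
have Q0 : 0 < 16 ^ t by rewrite expn_gt0.
have h : path_ge n d d (3 * n - 16 * d) by apply: path_ge_exit; lia.
case: (path_ge_stays n d d _ 30 t _ _ _ _ h); try lia.
move=> y hy yE; set Q := 16 ^ t in nQ Q0 yE.
apply: (path_ge_trans _ _ _ _ _ hy).
apply: (path_ge_trans _ _ (n - 4 * y)); first by apply: path_ge_stay; lia.
rewrite [X in path_ge _ _ _ X](_ : d = 3 * n - 16 * (n - 4 * y)); last by lia.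
by apply: path_ge_exit; lia.
Qed.

(** The first exit gives [S = 510], which is [2 * 255]. After the stays a second exit gives
    [S = - (128 * Q + 2)] with [Q = 16 ^ t], and two more stays return to [d]. *)
Lemma leader3 (t n d : nat) : n = 4 ^ (2 * t + 7) + 1 -> 40 * d + 255 = 7 * n ->
  path_ge n d d d.
Proof.
move=> nE dE.
have nQ : n = 128 * (128 * 16 ^ t) + 1.
  have e : 4 ^ 7 = 128 * 128 := expnMn 2 2 7.
  by rewrite nE expnD expnM mulnC e -mulnA.
have Q0 : 0 < 16 ^ t by rewrite expn_gt0.
have h : path_ge n d d (3 * n - 16 * d) by apply: path_ge_exit; lia.
case: (path_ge_stays n d d _ 510 t _ _ _ _ h); try lia.
move=> y hy yE; set Q := 16 ^ t in nQ Q0 yE.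
apply: (path_ge_trans _ _ _ _ _ hy).
apply: (path_ge_trans _ _ (n - 4 * y)); first by apply: path_ge_stay; lia.
set z := n - 4 * y; have zE : 5 * z + 2040 * Q = n by lia.
apply: (path_ge_trans _ _ (3 * n - 16 * z)); first by apply: path_ge_exit; lia.
set w := 3 * n - 16 * z; have wE : 5 * w + 128 * Q + 2 = n by lia.
apply: (path_ge_trans _ _ (n - 4 * w)); first by apply: path_ge_stay; lia.
rewrite [X in path_ge _ _ _ X](_ : d = n - 4 * (n - 4 * w)); last by lia.
by apply: path_ge_stay; lia.
Qed.

(** The first exit gives [S = 2 * 3855 = 15 * 514]. After the stays, three exits in succession
    return to [d]. *)
Lemma leader4 (t n d : nat) : n = 4 ^ (2 * t + 9) + 1 -> 40 * d + 3855 = 7 * n ->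
  path_ge n d d d.
Proof.
move=> nE dE.
have nQ : n = 512 * (512 * 16 ^ t) + 1.
  have e : 4 ^ 9 = 512 * 512 := expnMn 2 2 9.
  by rewrite nE expnD expnM mulnC e -mulnA.
have Q0 : 0 < 16 ^ t by rewrite expn_gt0.
have h : path_ge n d d (3 * n - 16 * d) by apply: path_ge_exit; lia.
case: (path_ge_stays n d d _ (15 * 514) t _ _ _ _ h); try lia.
move=> y hy yE; set Q := 16 ^ t in nQ Q0 yE.
apply: (path_ge_trans _ _ _ _ _ hy).
apply: (path_ge_trans _ _ (n - 4 * y)); first by apply: path_ge_stay; lia.
set z := n - 4 * y; have zE : 5 * z + 60 * (514 * Q) = n by lia.
apply: (path_ge_trans _ _ (3 * n - 16 * z)); first by apply: path_ge_exit; lia.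
set w := 3 * n - 16 * z.
apply: (path_ge_trans _ _ (3 * n - 16 * w)); first by apply: path_ge_exit; lia.
set v := 3 * n - 16 * w.
rewrite [X in path_ge _ _ _ X](_ : d = 3 * n - 16 * v); last by lia.
by apply: path_ge_exit; lia.
Qed.

(** * Orbits that stay above [delta_5] *)

Local Notation tent_iter n j y := (iter j (tent n) y).

(* As [40 delta_5 = 7 n - 4095] for [t > 2], this says that the orbit of [y] stays
   above [delta_5]. *)
Definition stays_high (n y : nat) : Prop :=
  forall j, 7 * n <= 40 * iter j (tent n) y + 4055.

Lemma stays_high_iter (n y j : nat) : stays_high n y -> stays_high n (tent_iter n j y).
Proof. by move=> h i; rewrite -iterD. Qed.

(** Staying high dictates the branch of the map at each step: below [3 * n / 16] the orbit makes an
    exit, otherwise a stay. The constant 113 is [3 * 40 - 7], from the requirement that the point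
    [3 * n - 16 * y] be high too. *)
Lemma high_low (n y : nat) : 512 * 512 <= n -> 2 * y <= n -> stays_high n y ->
  4 * y <= n ->
  [/\ tent_iter n 2 y = n - 4 * y,
   16 * y < 3 * n -> [/\ tent_iter n 4 y = 3 * n - 16 * y,
       4 * (3 * n - 16 * y) <= n & 16 * (40 * y) <= 113 * n + 4055]
   & 3 * n <= 16 * y -> 4 * (n - 4 * y) <= n].
Proof.
move=> n0 yn h h4.
have := (h 0, h 1, h 2, h 3, h 4, h 5); rewrite /= => -[[[[[]]]]].
have e1 : tent n y = 2 * y by rewrite /tent h4.
rewrite e1 => h0 h1 h2 h3 h5 h6.
have e2 : tent n (2 * y) = n - 4 * y by rewrite /tent; case: ifP; lia.
rewrite e2 in h2 h3 h5 h6 *; split => // hy; last by lia.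
have e3 : tent n (n - 4 * y) = 8 * y - n by move: h3; rewrite /tent; case: ifP; lia.
rewrite e3 in h3 h5 h6 *.
have e4 : tent n (8 * y - n) = 3 * n - 16 * y.
  by move: h5; rewrite /tent; case: ifP; lia.
rewrite e4 in h5 h6 *.
by split => //; lia.
Qed.

(* Where [4 y > n] the map doubles the distance to the fixed point [n / 3]. *)
Lemma orbit_low (n y : nat) : 2 * y <= n -> 3 * y != n ->
  exists j, 4 * tent_iter n j y <= n.
Proof.
(* A point between [n / 4] and [n / 3] is sent above [n / 3]. *)
wlog ny : y / n < 3 * y => [hw|] yn y3.
  have [/hw|yn3] := ltnP n (3 * y); first exact.
  have [?|?] := leqP (4 * y) n; first by exists 0.
  have e : tent n y = n - 2 * y by rewrite /tent; case: ifP; lia.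
  case: (hw (tent n y)); rewrite ?e; [lia | lia | lia |].
  by move=> j hj; exists j.+1; rewrite iterSr e.
have [/existsP[j hj]|] := boolP [exists j : 'I_(2 * n).+1, 4 * tent_iter n j y <= n].
  by exists j.
rewrite negb_exists => /forallP h.
(* The excess over the fixed point quadruples every two steps, which cannot go on below [n / 2]. *)
have E k : k <= n -> n + 4 ^ k <= 3 * tent_iter n (2 * k) y.
  elim: k => [_|k IH kn]; first by rewrite muln0 expn0 addn1.
  have k1 : (2 * k) < (2 * n).+1 by lia.
  have k2 : (2 * k).+1 < (2 * n).+1 by lia.
  have := h (Ordinal k1); have := h (Ordinal k2); move: (IH (ltnW kn)).
  have := iter_tent_half n y (2 * k) yn; have := iter_tent_half n y (2 * k).+1 yn.
  rewrite mulnS add2n expnS /=; set w := iter (2 * k) _ _; set p := 4 ^ k.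
  have e z : n < 4 * z -> tent n z = n - 2 * z by rewrite /tent; case: ifP; lia.
  rewrite -!ltnNge => h1 h2 h3 /e e1 /e e2.
  by move: h1; rewrite e1 e2; lia.
have := E n (leqnn n); have := iter_tent_half n y (2 * n) yn.
have : n < 4 ^ n by rewrite ltn_expl.
by lia.
Qed.

(** From a point of [[3 * n / 16, n / 5]] a stay lands at or above [n / 5], so the next move is a
    stay as well; together they multiply [s] by 16. *)
Lemma high_double_stay (n u s : nat) : 512 * 512 <= n -> 2 * u <= n ->
  stays_high n u -> 4 * u <= n -> 3 * n <= 16 * u -> 5 * u + s = n ->
  [/\ tent_iter n 4 u = n - 4 * (n - 4 * u), 4 * tent_iter n 4 u <= n
     & 5 * tent_iter n 4 u + 16 * s = n].
Proof.
move=> n0 un h u4 u3 us.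
have [e2 _ /(_ u3) w4] := high_low n u n0 un h u4.
have h2 : stays_high n (n - 4 * u) by rewrite -e2; apply: stays_high_iter.
have wn : 2 * (n - 4 * u) <= n by lia.
have [e4 _ h4] := high_low n (n - 4 * u) n0 wn h2 w4.
have -> : tent_iter n 4 u = tent_iter n 2 (tent_iter n 2 u) by [].
rewrite e2 e4.
have {}h4 : 4 * (n - 4 * (n - 4 * u)) <= n by apply: h4; lia.
have := h2 2; rewrite e4; split=> //; lia.
Qed.

(** Double stays make the distance [s] grow by 16 each time, so the orbit must drop below
    [3 * n / 16]. The last equation is [5 * v + s * 16 ^ r = n], scaled by 8 for comparison with
    [7 * n / 40]. *)
Lemma low_window (n u s : nat) : 512 * 512 <= n -> 2 * u <= n ->
  stays_high n u -> 4 * u <= n -> 5 * u + s = n -> 0 < s ->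
  exists r j, let v := tent_iter n j u in
    [/\ 4 * v <= n, 16 * v < 3 * n & 40 * v + 8 * (s * 16 ^ r) = 8 * n].
Proof.
move=> n0 un h u4 us s0.
have claim r : (exists r j, let v := tent_iter n j u in
    [/\ 4 * v <= n, 16 * v < 3 * n & 40 * v + 8 * (s * 16 ^ r) = 8 * n]) \/
    exists j, let v := tent_iter n j u in 4 * v <= n /\ 5 * v + s * 16 ^ r = n.
  elim: r => [|r [IH|[j [v4 vs]]]]; [ | by left | ].
    by right; exists 0; rewrite muln1.
  have [v3|v3] := ltnP (16 * tent_iter n j u) (3 * n).
    by left; exists r, j; split => //; lia.
  have vn := iter_tent_half n u j un.
  have [_ w4 ws] := high_double_stay n _ _ n0 vn (stays_high_iter n u j h) v4 v3 vs.
  right; exists (4 + j); rewrite /= iterD; split => //.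
  by rewrite expnS mulnCA.
case: (claim n) => // -[j [_]].
have : n < 16 ^ n by rewrite ltn_expl.
by nia.
Qed.

(** Otherwise every block of four steps, double stay or exit with [D > 0], leads from below [n / 5]
    to below [n / 5]. After [4 * t] steps the two remaining steps of the period land above [n / 5],
    although they must return to [y]. *)
Lemma negative_exit (t n y : nat) : n = (2 ^ (4 * t + 2)).+1 ->
  512 * 512 <= n -> 2 * y <= n -> stays_high n y -> 4 * y <= n -> 5 * y < n ->
  exists j, let v := tent_iter n j y in
    [/\ 4 * v <= n, 16 * v < 3 * n & 40 * v < 7 * n].
Proof.
move=> nE n0 yn h y4 y5.
have [/existsP[j /and3P[? ? ?]]|] := boolP [exists j : 'I_(4 * t).+1,
  [&& 4 * tent_iter n j y <= n, 16 * tent_iter n j y < 3 * n & 40 * tent_iter n j y < 7 * n]].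
  by exists j; split.
rewrite negb_exists => /forallP neg.
(* Since [n] is odd, [40 * u = 7 * n] is impossible, which makes the inequality after an exit
   strict. *)
have odd_n : 2 %| 2 ^ (4 * t + 2) by rewrite addnS expnS dvdn_mulr.
have E k : k <= t -> 4 * tent_iter n (4 * k) y <= n /\ 5 * tent_iter n (4 * k) y < n.
  elim: k => [|k IH kt]; first by rewrite muln0.
  have [u4 u5] := IH (ltnW kt).
  have un := iter_tent_half n y (4 * k) yn.
  have uh := stays_high_iter n y (4 * k) h.
  have kt4 : 4 * k < (4 * t).+1 by lia.
  have : ~~ [&& 4 * tent_iter n (4 * k) y <= n, 16 * tent_iter n (4 * k) y < 3 * n
             & 40 * tent_iter n (4 * k) y < 7 * n] := neg (Ordinal kt4).
  rewrite u4 andTb mulnS iterD.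
  set u := iter (4 * k) _ _ in u4 u5 un uh *.
  have [u3|u3] := ltnP (16 * u) (3 * n).
    rewrite andTb -leqNgt => u7.
    have [_ /(_ u3)[e e4 _] _] := high_low n u n0 un uh u4.
    by rewrite [iter 4 _ _]e; split => //; lia.
  move=> _; have us : 5 * u + (n - 5 * u) = n by lia.
  have [_ w4 ws] := high_double_stay n _ _ n0 un uh u4 u3 us.
  by split=> //; lia.
have [u4 u5] := E t (leqnn t).
have := tent_period (4 * t + 2) y; rewrite -nE => /(_ yn).
rewrite addnC iterD; move: u4 u5; set u := iter (4 * t) _ _ => u4 u5.
have un : 2 * u <= n by apply: iter_tent_half.
have uh := stays_high_iter n y (4 * t) h.
have [e _ w4] := high_low n u n0 un uh u4.
by rewrite e; have := stays_high_iter n y (4 * t) h 2; rewrite -/u e; lia.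
Qed.

(** This and the next lemma compare [d] with a constant while [B * d] stays an atom, so that linear
    arithmetic suffices. *)
Lemma leq_or_mul (B k d : nat) : d <= k \/ B * k.+1 <= B * d.
Proof. by have [?|?] := leqP d k; [left | right; rewrite leq_mul2l orbC; lia]. Qed.

Lemma geq_or_mul (B k d : nat) : k < d \/ B * d <= B * k.
Proof. by have [?|?] := leqP d k; [right; rewrite leq_mul2l orbC; lia | left]. Qed.

(** With [f = t - (r + 1)] the two bounds put [d] roughly between [15 / 16] of [16 ^ f] and
    [16 ^ f]. As [d] is 15 modulo 40 and at most 4055, [f] is 1, 2 or 3; for [f = 3] several values
    remain, and [B = 4 * 16 ^ r.+1]. *)
Lemma window_digit (t n d r : nat) : 4 <= t -> n = 4 * 16 ^ t + 1 ->
  0 < d -> d <= 4055 -> (exists c, d = 40 * c + 15) ->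
  64 * (d * 16 ^ r) <= n + 4055 -> 15 * n <= 16 * (64 * (d * 16 ^ r)) + 4055 ->
  [\/ d = 15, d = 255 |
   3855 <= d /\ exists B, [/\ 64 <= B, n = 64 * (64 * B) + 1 &
     64 * (d * 16 ^ r) = B * d]].
Proof.
move=> t4 nE d0 dK [c dE] up lo.
have XE : 64 * (d * 16 ^ r) = (4 * 16 ^ r.+1) * d by rewrite expnS; lia.
rewrite XE in up lo *.
have [tr|rt] := leqP t r.+1.
  have : 16 ^ t <= 16 ^ r.+1 by rewrite leq_exp2l.
  have : 64 * (8 * 16) <= 16 ^ t.
    by apply: (@leq_trans (16 ^ 4)); rewrite ?leq_exp2l //; rewrite (expnD 16 2 2); lia.
  have := geq_or_mul (4 * 16 ^ r.+1) 14 d.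
  by move: up; set p := _ * d; lia.
have [f [f0 tE]] : exists f, 0 < f /\ t = f + r.+1.
  by exists (t - r.+1); split; lia.
have {}nE : n = 16 ^ f * (4 * 16 ^ r.+1) + 1 by rewrite nE tE expnD; lia.
set B := 4 * 16 ^ r.+1 in nE up lo *.
have BE e : e <= r.+1 -> 4 * 16 ^ e <= B by move=> er; rewrite leq_mul2l leq_exp2l.
case: f f0 nE tE => [//|[|[|[|f]]]] _ nE tE.
- have B4 : 4 * 16 ^ 3 <= B by apply: BE; lia.
  rewrite (expnD 16 1 2) in B4; rewrite expn1 in nE B4.
  have := leq_or_mul B 16 d; have := geq_or_mul B 14 d.
  by move: up lo; set p := B * d; constructor 1; lia.
- have B4 : 4 * 16 ^ 2 <= B by apply: BE; lia.
  rewrite -mulnn in nE B4.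
  have := leq_or_mul B 260 d; have := geq_or_mul B 239 d.
  by move: up lo; set p := B * d; constructor 2; lia.
- have B4 : 4 * 16 ^ 1 <= B by apply: BE; lia.
  rewrite (expnD 16 1 2) -mulnn expn1 in nE B4.
  have := geq_or_mul B 3835 d.
  move: up lo; set p := B * d; constructor 3; split; first lia.
  by exists B; split => //; lia.
have B4 : 4 * 16 ^ 1 <= B by apply: BE; lia.
have F4 : 16 ^ 4 * B <= 16 ^ f.+4 * B by rewrite leq_mul2r leq_exp2l ?orbT.
have := leq_mul (leqnn B) dK; rewrite (expnD 16 2 2) -mulnn in F4.
by move: up lo; set p := B * d; lia.
Qed.

(** Here [D = 40 * z - 7 * n] is [(4096 - d) * B + 1], and the second exit needs [16 * D * 16 ^ r]
    between about [3840 * B] and [4096 * B]. As [4096 - d] lies in [[41, 201]], this is too small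
    for [r = 0] and too large for [r > 0]. *)
Lemma no_second_window (n B d z q r : nat) : 64 <= B -> n = 64 * (64 * B) + 1 ->
  3895 <= d <= 4055 -> 40 * z + B * d = 8 * n ->
  40 * q + 8 * ((80 * z - 14 * n) * 16 ^ r) = 8 * n ->
  7 * n <= 40 * q + 4055 -> 16 * (40 * q) <= 113 * n + 4055 -> False.
Proof.
move=> B0 nB /andP[d1 d2] zB qE q0 q1.
have BD1 := leq_mul (leqnn B) d1; have BD2 := leq_mul (leqnn B) d2.
case: r qE => [|r]; first by rewrite expn0 muln1; lia.
have : 16 <= 16 ^ r.+1 by rewrite expnS leq_pmulr // expn_gt0.
move=> /(leq_mul (leqnn (80 * z - 14 * n))).
by set p := (80 * z - 14 * n) * 16 ^ _; lia.
Qed.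

Lemma orbit_meets_leaders (t n y : nat) : n = (2 ^ (4 * t + 2)).+1 -> 4 <= t ->
  2 * y <= n -> stays_high n y ->
  exists j, let v := iter j (tent n) y in
    [\/ 5 * v = n, 40 * v + 15 = 7 * n, 40 * v + 255 = 7 * n
      | 40 * v + 3855 = 7 * n].
Proof.
move=> nE t4 yn h.
have nQ : n = 4 * 16 ^ t + 1 by rewrite nE expnD (expnM 2 4 t) mulnC addn1.
have n0 : 512 * 512 <= n.
  have : 16 ^ 4 <= 16 ^ t by rewrite leq_exp2l.
  by rewrite nQ (expnD 16 2 2) -mulnn; lia.
(* This makes [7 * n - 40 * v] equal to 15 modulo 40 for every [v]. *)
have [c nc] : exists c, n = 40 * c + 25.
  have [q qE] : exists q, 16 ^ t = 40 * q + 16.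
    elim: t {nE nQ} t4 => // -[//|t] IH; rewrite leq_eqVlt => /orP[/eqP[<-]|].
      by exists (16 * 102 + 6); rewrite (expnD 16 2 2) -mulnn; lia.
    by move=> /IH[q qE]; exists (16 * q + 6); rewrite expnS qE; lia.
  by exists (4 * q + 1); rewrite nQ qE; lia.
(* The fixed point [n / 3] is not an integer, as [n] is 2 modulo 3. *)
have n3 : 3 * y != n.
  have [q qE] : exists q, 16 ^ t = 3 * q + 1.
    elim: (t) => [|k [q qE]]; first by exists 0.
    by exists (16 * q + 5); rewrite expnS qE; lia.
  by apply/eqP; lia.
have [j1 u4] := orbit_low n y yn n3.
have un := iter_tent_half n y j1 yn; have uh := stays_high_iter n y j1 h.
set u := iter j1 _ _ in u4 un uh.
have [ue|ue] := eqVneq (5 * u) n; first by exists j1; constructor 1.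
have [j2] : exists j, let v := iter j (tent n) u in
  [/\ 4 * v <= n, 16 * v < 3 * n & 40 * v < 7 * n].
  have [u5|u5] := ltnP (5 * u) n; first exact: (negative_exit t).
  (* Above [n / 5], one stay first moves the point below [n / 5]. *)
  have [e _ w4] := high_low n u n0 un uh u4.
  have {}w4 : 4 * (n - 4 * u) <= n by apply: w4; lia.
  have [||||j hj] := negative_exit t n (n - 4 * u) nE n0; [lia | | lia | lia |].
    by rewrite -e; apply: stays_high_iter.
  by exists (j + 2); rewrite /= iterD [iter 2 _ _]e.
set v := iter j2 _ _ => -[v4 v3 v7].
have vn : 2 * v <= n by apply: iter_tent_half.
have vh : stays_high n v by apply: stays_high_iter.
have [_ /(_ v3)[e w4 _] _] := high_low n v n0 vn vh v4.
set w := 3 * n - 16 * v in e w4.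
have wh : stays_high n w by rewrite -e; apply: stays_high_iter.
have wn : 2 * w <= n by lia.
have [e2 _ x4] := high_low n w n0 wn wh w4.
have {}x4 : 4 * (n - 4 * w) <= n by apply: x4; lia.
set x := n - 4 * w in e2 x4.
have xh : stays_high n x by rewrite -e2; apply: stays_high_iter.
pose d := 7 * n - 40 * v.
have v0 := vh 0; rewrite /= in v0.
(* The exit at [v] gives [S = 2 * d] at [w], and the stay from [w] gives [S = -8 * d] at [x]. *)
have [|||r [j3]] := low_window n x (8 * d) n0 _ xh x4;
  [lia | rewrite /d; lia | rewrite /d; lia |].
set z := iter j3 _ _ => -[z4 z3 zE].
have zn : 2 * z <= n by apply: iter_tent_half; lia.
have zh : stays_high n z by apply: stays_high_iter.
have z0 := zh 0; rewrite /= in z0.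
have [_ /(_ z3)[ez s4 z1] _] := high_low n z n0 zn zh z4.
have hd : exists c', d = 40 * c' + 15 by exists (7 * c + 4 - v); rewrite /d; lia.
have [||||d15|d255|[d3855 [B [B0 nB dB]]]] := window_digit t n d r t4 nQ _ _ hd;
  [rewrite /d; lia | rewrite /d; lia | lia | lia | | |].
- exists (j2 + j1); rewrite iterD -/u -/v; constructor 2; move: d15; rewrite /d; lia.
- exists (j2 + j1); rewrite iterD -/u -/v; constructor 3; move: d255; rewrite /d; lia.
have [d3|d3] := eqVneq d 3855.
  exists (j2 + j1); rewrite iterD -/u -/v; constructor 4; move: d3; rewrite /d; lia.
(* There remain the values 3895 to 4055 of [d]. For them the exit at [z] has [D > 0], so the orbit
   goes below [n / 5] and needs another exit, at [q]. *)
exfalso.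
have sh : stays_high n (3 * n - 16 * z) by rewrite -ez; apply: stays_high_iter.
have d4 : 3895 <= d by case: hd => c'; lia.
have d5 : d <= 4055 by rewrite /d; lia.
have zB : 40 * z + B * d = 8 * n by lia.
have z7 : 7 * n < 40 * z.
  by have := leq_mul (leqnn B) d5; move: zB nB B0; clear; lia.
have [|||r' [j4]] := low_window n (3 * n - 16 * z) (80 * z - 14 * n) n0 _ sh s4;
  [move: s4; clear; lia | move: z3 z7; clear; lia | move: z7; clear; lia |
   set q := iter j4 _ _ => -[q4 q3 qE]].
have qn : 2 * q <= n by apply: iter_tent_half; move: s4; clear; lia.
have qh : stays_high n q by apply: stays_high_iter.
have q0 := qh 0; rewrite /= in q0.
have [_ /(_ q3)[_ _ q1] _] := high_low n q n0 qn qh q4.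
apply: (no_second_window n B d z q r') => //.
by rewrite d4.
Qed.

(** * Large coset leaders *)

Lemma conj2_tent (m y j : nat) : 2 * y <= (2 ^ m).+1 ->
  conj2 (2 ^ m).+1 y (iter j (tent (2 ^ m).+1) y).
Proof.
move=> yn; case: (iter_tent_mod _ _ j yn) => h; first by exists j; rewrite h.
by apply: (conj2_neg _ _ _ j); rewrite addnC.
Qed.

Lemma tent_gt0 (n y : nat) : odd n -> 0 < y -> 2 * y <= n -> 0 < tent n y.
Proof. by move=> /odd2[k]; rewrite /tent; case: ifP; lia. Qed.

Lemma iter_tent_gt0 (n y j : nat) : odd n -> 0 < y -> 2 * y <= n ->
  0 < iter j (tent n) y.
Proof.
move=> on y0 yn; elim: j => // j IH.
by rewrite iterS tent_gt0 // iter_tent_half.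
Qed.

(** A member of the coset of [d] is an iterate [w] of the tent map or its complement [n - w], and
    the latter is at least [n / 2]. *)
Lemma leader_min (m d z : nat) : 0 < m -> 2 * d <= (2 ^ m).+1 ->
  (forall j, d <= iter j (tent (2 ^ m).+1) d) ->
  conj2 (2 ^ m).+1 d z -> 0 < z < (2 ^ m).+1 -> d <= z.
Proof.
move=> m0; set n := (2 ^ m).+1 => dn lead [j dz] /andP[z0 zn].
have wn := iter_tent_half n d j dn; have := lead j.
have := iter_tent_mod n d j dn; set w := iter j _ _ in wn * => h dw.
have w1 : w < n by move: wn; rewrite /n; clear; lia.
case: h => h; first by move: h; rewrite dz !modn_small // => <-.
have /dvdnP[q] : n %| w + z by rewrite /dvdn -modnDmr -dz modnDmr.
move=> wz; have {h lead} : n <= w + z.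
  rewrite wz leq_pmull //; case: q wz => //; move: z0; clear; lia.
by move: wn dw; clear; lia.
Qed.

Definition is_leader (n d : nat) : Prop := forall j, d <= iter j (tent n) d.

Lemma pow4_16 (t : nat) : (2 ^ (4 * t + 2)).+1 = 4 * 16 ^ t + 1.
Proof. by rewrite expnD (expnM 2 4 t) mulnC addn1. Qed.

Lemma dlt12E (t : nat) : 1 < t -> let n := (2 ^ (4 * t + 2)).+1 in
  5 * dlt t 1 = n /\ 40 * dlt t 2 + 15 = 7 * n.
Proof.
move=> t2 n; rewrite /n pow4_16 /= /dlt2 pow4_16.
(* This residue makes both divisions by 5 exact. *)
have [q qE] : exists q, 16 ^ t = 80 * q + 16.
  elim: t t2 {n} => // -[//|[|t]] IH _; first by exists 3.
  by have [q qE] := IH isT; exists (16 * q + 3); rewrite expnS qE; lia.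
have -> : 2 ^ (4 * t - 1) = 40 * q + 8.
  have : 2 ^ (4 * t) = 2 * 2 ^ (4 * t - 1) by rewrite -expnS; congr (2 ^ _); lia.
  by rewrite (expnM 2 4) qE; lia.
rewrite (expnM 2 4) qE.
have -> : 4 * (80 * q + 16) + 1 = (64 * q + 13) * 5 by lia.
have -> : 80 * q + 16 - 1 = (16 * q + 3) * 5 by lia.
by rewrite !mulnK //; lia.
Qed.

Lemma dlt_large (t : nat) : 2 < t -> let n := (2 ^ (4 * t + 2)).+1 in
  [/\ 40 * dlt t 3 + 255 = 7 * n, 40 * dlt t 4 + 3855 = 7 * n
    & 40 * dlt t 5 + 4095 = 7 * n].
Proof.
move=> t3 n; have [_] := dlt12E t (ltnW t3); rewrite -/n /= => d2.
have n1 : 128 * 128 <= n.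
  rewrite /n pow4_16; have : 16 ^ 3 <= 16 ^ t by rewrite leq_exp2l.
  by rewrite (expnD 16 1 2) -mulnn expn1; lia.
by rewrite (gtn_eqF t3); split; lia.
Qed.

Lemma dlt_decr (t : nat) : 1 < t ->
  [/\ 0 < dlt t 5, dlt t 5 < dlt t 4, dlt t 4 < dlt t 3, dlt t 3 < dlt t 2
    & dlt t 2 < dlt t 1].
Proof.
move=> t2; have [d1 d2] := dlt12E t t2.
move: t2; rewrite leq_eqVlt => /orP[/eqP te|t3]; first by rewrite -te.
have [d3 d4 d5] := dlt_large t t3.
have n1 : 128 * 128 <= (2 ^ (4 * t + 2)).+1.
  rewrite pow4_16; have : 16 ^ 3 <= 16 ^ t by rewrite leq_exp2l.
  by rewrite (expnD 16 1 2) -mulnn expn1; lia.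
by split; lia.
Qed.

Lemma leader_check (m d : nat) : 2 * d <= (2 ^ m).+1 -> 0 < m ->
  all (fun j => d <= iter j (tent (2 ^ m).+1) d) (iota 0 m) ->
  is_leader (2 ^ m).+1 d.
Proof.
move=> dn m0 /allP h; apply: (tent_loop _ m d (leq d)) => //.
  exact: tent_period.
by move=> i im; apply: h; rewrite mem_iota.
Qed.

(** As [n = 4 ^ (2 * t + 1) + 1], [leader3] and [leader4] start at [t = 3] and [t = 4]; the smaller
    [t] are computed. *)
Lemma dlt_leader (t i : nat) : 1 < t -> 0 < i <= 4 ->
  is_leader (2 ^ (4 * t + 2)).+1 (dlt t i).
Proof.
move=> t2; have [d1 d2] := dlt12E t t2.
case: i => [|[|[|[|[|i]]]]] // _.
- apply: path_ge_loop; set n := (2 ^ (4 * t + 2)).+1 in d1 d2 *; set d := dlt t 1 in d1 *.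
  have e1 : tent n d = 2 * d by rewrite /tent; case: ifP; lia.
  have e2 : tent n (2 * d) = d by rewrite /tent; case: ifP; lia.
  apply: (path_ge_trans _ _ (2 * d)); first by rewrite -e1; apply: path_ge_step.
  by rewrite -[X in path_ge _ _ _ X]e2; apply: path_ge_step; lia.
- apply: path_ge_loop; apply: (leader2 (t - 2)) d2.
  by rewrite -addn1 (_ : 4 * t + 2 = 2 * (2 * (t - 2) + 5)) ?expnM //; lia.
- move: t2; rewrite leq_eqVlt => /orP[/eqP te|t3].
    by apply: leader_check; rewrite ?addn2 // -te; vm_compute.
  have [d3 _ _] := dlt_large t t3.
  apply: path_ge_loop; apply: (leader3 (t - 3)) d3.
  by rewrite -addn1 (_ : 4 * t + 2 = 2 * (2 * (t - 3) + 7)) ?expnM //; lia.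
move: t2; rewrite leq_eqVlt => /orP[/eqP te|t3].
  by apply: leader_check; rewrite ?addn2 // -te; vm_compute.
have [_ d4 _] := dlt_large t t3.
move: t3; rewrite leq_eqVlt => /orP[/eqP te|t4].
  by apply: leader_check; rewrite ?addn2 // -te; vm_compute.
apply: path_ge_loop; apply: (leader4 (t - 4)) d4.
by rewrite -addn1 (_ : 4 * t + 2 = 2 * (2 * (t - 4) + 9)) ?expnM //; lia.
Qed.

(** * Sizes of the large cosets *)

Lemma card_cyc_coset_coprime (m n' x : nat) : 10 <= m ->
  (2 ^ m).+1 = 5 * n' -> 0 < x < (2 ^ m).+1 -> coprime n' x ->
  #|cyc_coset (2 ^ m) x| = 2 * m.
Proof.
move=> m10 nE xn cop; apply: card_cyc_coset_full => //; first lia.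
move=> j /andP[j0 jm].
have m1024 : 1024 <= 2 ^ m by rewrite -[1024]/(2 ^ 10) leq_exp2l.
have [p [p0 mj]] : exists p, 0 < p /\ 2 ^ m = 2 ^ p * 2 ^ j.
  by exists (m - j); rewrite -expnD subnK ?subn_gt0 // ltnW.
have ndiv a : n' %| x * a -> n' %| a by rewrite Gauss_dvdr.
have n'n : n' %| (2 ^ m).+1 by rewrite nE dvdn_mull.
have [k jE] : exists k, 2 ^ j = 2 * k by exists (2 ^ j.-1); rewrite -expnS prednK.
have m3 : [\/ 2 ^ m = 2 * 2 ^ j, 2 ^ m = 4 * 2 ^ j | 8 * 2 ^ j <= 2 ^ m].
  case: p p0 mj => [|[|[|p]]] // _ ->; [constructor 1 | constructor 2 | constructor 3] => //.
  by rewrite !expnS !mulnA leq_mul2r leq_pmulr ?expn_gt0 // orbT.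
move: m3 jE nE m1024; set P := 2 ^ j; set M := 2 ^ m => m3 jE nE m1024.
(* A short period would give [q * n = 5 * (P - 1)] or [5 * (P + 1)], with [n = M + 1] and [M] equal
   to [2 * P], [4 * P] or at least [8 * P]; size and parity exclude every [q]. *)
have cases5 q : q * n' = P - 1 \/ q * n' = P + 1 -> False.
  move: m3 jE nE m1024; clear; case: q => [|[|[|q]]]; rewrite ?mulSn ?mul0n;
    try (move: (q * n') => w); case=> ? ? ? ? [] ?; lia.
split=> [h|]; last first.
  apply/negP => h; have /ndiv/dvdnP[q qE] : n' %| x * (P + 1).
    by rewrite mulnDr muln1; apply: dvdn_trans h.
  by apply: (cases5 q); right.
have /ndiv/dvdnP[q qE] : n' %| x * (P - 1).
  apply: dvdn_trans n'n _; rewrite mulnBr muln1 -eqn_mod_dvd ?h //.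
  by rewrite leq_pmulr // /P expn_gt0.
by apply: (cases5 q); left.
Qed.

(** These primes come from [15 = 3 * 5], [255 = 15 * 17] and [3855 = 15 * 257]. The powers of 16
    take one, two and four residues modulo 3, 17 and 257, none of which makes [4 * 16 ^ t + 1]
    vanish. *)
Lemma coprime_3_17_257 (t : nat) : coprime (4 * 16 ^ t + 1) (3 * (17 * 257)).
Proof.
have h3 : exists q, 16 ^ t = 3 * q + 1.
  elim: t => [|t [q qE]]; first by exists 0.
  by exists (16 * q + 5); rewrite expnS qE; lia.
have h17 : exists q, 16 ^ t = 17 * q + 1 \/ 16 ^ t = 17 * q + 16.
  elim: t {h3} => [|t [q [qE|qE]]]; first by exists 0; left.
    by exists (16 * q); right; rewrite expnS qE; lia.
  by exists (16 * q + 15); left; rewrite expnS qE; lia.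
have h257 : exists q, [\/ 16 ^ t = 257 * q + 1, 16 ^ t = 257 * q + 16,
    16 ^ t = 257 * q + 256 | 16 ^ t = 257 * q + 241].
  elim: t {h3 h17} => [|t [q [] qE]]; first by exists 0; constructor 1.
  - by exists (16 * q); constructor 2; rewrite expnS qE; lia.
  - by exists (16 * q); constructor 3; rewrite expnS qE; lia.
  - by exists (16 * q + 15); constructor 4; rewrite expnS qE; lia.
  by exists (16 * q + 15); constructor 1; rewrite expnS qE; lia.
rewrite !coprimeMr; apply/and3P; split; rewrite coprime_sym prime_coprime //.
- by case: h3 => q ->; lia.
- by case: h17 => q [] ->; lia.
by case: h257 => q [] ->; lia.
Qed.

(** On multiples of [n / 5] doubling acts as on residues modulo 5, where 2 has order 4. *)
Lemma card_dlt1 (t : nat) : 1 < t -> #|cyc_coset (2 ^ (4 * t + 2)) (dlt t 1)| = 4.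
Proof.
move=> t2; have [d1 _] := dlt12E t t2; have [_ _ _ _ d0] := dlt_decr t t2.
move: (dlt t 1) (dlt t 2) d1 d0 => d d' d1 d0.
have d0' : 0 < d by apply: leq_ltn_trans d0.
apply: card_cyc_coset; [by rewrite addn2 | by [] | |]; rewrite -d1.
  rewrite (_ : d * 2 ^ 4 = 3 * (5 * d) + d) ?modnMDl //.
  by rewrite -[2 ^ 4]/16; lia.
move=> j /andP[j0 j4] h.
have : 5 * d %| d * 2 ^ j - d by rewrite -eqn_mod_dvd ?h // leq_pmulr ?expn_gt0.
rewrite (_ : _ - d = d * (2 ^ j - 1));
  last by rewrite mulnBr muln1.
rewrite [5 * d]mulnC dvdn_pmul2l //.
by case: j j0 j4 {h} => [|[|[|[|]]]].
Qed.

Lemma coprime_linear (a b c p d : nat) :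
  a * d + c = b * p -> coprime p c -> coprime p d.
Proof.
move=> dE /eqP pc; have : gcdn p d %| gcdn p c.
  rewrite dvdn_gcd dvdn_gcdl -(dvdn_addr _ (dvdn_mull a (dvdn_gcdr p d))) dE.
  by rewrite dvdn_mull ?dvdn_gcdl.
by rewrite pc dvdn1.
Qed.

Lemma card_dlt (t i : nat) : 1 < t -> 1 < i <= 4 ->
  #|cyc_coset (2 ^ (4 * t + 2)) (dlt t i)| = 2 * (4 * t + 2).
Proof.
move=> t2 i4; have [d1 d2] := dlt12E t t2.
have [e5 e4 e3 e2 e1] := dlt_decr t t2.
apply: (card_cyc_coset_coprime _ (dlt t 1)) => //; first lia.
  rewrite -d1; case: i i4 => [|[|[|[|[|]]]]] // _; move: e5 e4 e3 e2 e1; clear.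
  - by lia.
  - by lia.
  - by lia.
move: t2; rewrite leq_eqVlt => /orP[/eqP te|t3].
  by rewrite -te; case: i i4 => [|[|[|[|[|]]]]] // _; vm_compute.
have [d3 d4 _] := dlt_large t t3.
(* Dividing by 5, a common divisor of [d] and [n / 5] divides [3 * e]. *)
have cop e d : 40 * d + 15 * e = 7 * (5 * dlt t 1) -> e %| 17 * 257 ->
    coprime (dlt t 1) d.
  move=> dE eK.
  have : coprime (dlt t 1) (3 * e).
    apply: (coprime_dvdr (dvdn_mul (dvdnn 3) eK)).
    apply: (coprime_dvdl _ (coprime_3_17_257 t)).
    by rewrite -pow4_16 -d1 dvdn_mull.
  by apply: (coprime_linear 8 7); lia.
case: i i4 => [|[|[|[|[|]]]]] // _; rewrite -d1 in d2 d3 d4.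
- by apply: (cop 1).
- by apply: (cop 17); [lia | rewrite dvdn_mulr].
- by apply: (cop 257); [lia | rewrite dvdn_mull].
Qed.

(* The orbit analysis needs [n >= 2 ^ 18]; the cases [t = 2, 3] are computed. *)
Definition tentN (n y : N) : N :=
  if N.leb (N.double (N.double y)) n then N.double y else N.sub n (N.double y).

Fixpoint hitN (n d : N) (r : seq N) (k : nat) (y : N) : bool :=
  [|| N.leb y d, has (N.eqb y) r | if k is k'.+1 then hitN n d r k' (tentN n y) else false].

Definition hit (t v : nat) : Prop :=
  v <= dlt t 5 \/ exists2 k, 0 < k <= 4 & v = dlt t k.

Lemma tentNE (n y : N) : N.to_nat (tentN n y) = tent (N.to_nat n) (N.to_nat y).
Proof. by rewrite /tentN /tent; case: N.leb_spec => h; case: ifP => h'; lia. Qed.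

Lemma hitN_sound (t : nat) (n d : N) (r : seq N) (k : nat) (y : N) :
  N.to_nat d = dlt t 5 -> [seq N.to_nat v | v <- r] = [seq dlt t i | i <- iota 1 4] ->
  hitN n d r k y -> exists j, hit t (iter j (tent (N.to_nat n)) (N.to_nat y)).
Proof.
move=> dE rE.
have base v : N.leb v d || has (N.eqb v) r -> hit t (N.to_nat v).
  case/orP=> [/N.leb_spec0 h | /hasP[w wr /N.eqb_eq ->]].
    by left; rewrite -dE; lia.
  right; have : N.to_nat w \in [seq N.to_nat v | v <- r] by apply: map_f.
  by rewrite rE => /mapP[i]; rewrite mem_iota => i4 wi; exists i.
elim: k y => [|k IH] y; rewrite [hitN _ _ _ _ _]/= orbA.
  by rewrite orbF => /base; exists 0.
case/orP=> [/base|]; first by exists 0.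
by move=> /IH[j]; rewrite tentNE => hj; exists j.+1; rewrite iterSr.
Qed.

Lemma orbit_hits_check (t h : nat) (n d : N) (r : seq N) (k : nat) :
  N.to_nat n = (2 ^ (4 * t + 2)).+1 -> N.to_nat d = dlt t 5 ->
  [seq N.to_nat v | v <- r] = [seq dlt t i | i <- iota 1 4] ->
  2 * h = 2 ^ (4 * t + 2) ->
  all (fun i => hitN n d r k (N.of_nat i)) (iota 1 h) ->
  forall y, 2 * y <= (2 ^ (4 * t + 2)).+1 -> 0 < y ->
  exists j, hit t (iter j (tent (2 ^ (4 * t + 2)).+1) y).
Proof.
move=> nE dE rE hE /allP chk y yn y0.
have yh : y \in iota 1 h by rewrite mem_iota; lia.
by have := hitN_sound t n d r k _ dE rE (chk y yh); rewrite nE Nat2N.id.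
Qed.

Lemma orbit_hits (t y : nat) : 1 < t -> 2 * y <= (2 ^ (4 * t + 2)).+1 -> 0 < y ->
  exists j, hit t (iter j (tent (2 ^ (4 * t + 2)).+1) y).
Proof.
move=> t2 yn y0; case: (ltngtP t 3) => t3.
- have te : t = 2 by lia.
  rewrite te in yn *; move: y yn y0.
  (* The data are [(n - 1) / 2], [n], [delta_5], the list of [delta_1] to [delta_4], and the period
     [m] as fuel. *)
  by apply: (orbit_hits_check 2 512 1025%num 155%num [:: 205; 179; 173; 171]%num 10);
    vm_compute.
- have [_ _ d5] := dlt_large t (ltnW t3).
  set n := (2 ^ (4 * t + 2)).+1 in yn d5 *.
  have [/forallP h|] := boolP [forall j : 'I_(4 * t + 2),
      7 * n <= 40 * iter j (tent n) y + 4055].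
    have hh : stays_high n y.
      apply: (tent_loop n (4 * t + 2) y (fun v => 7 * n <= 40 * v + 4055)).
      - by rewrite addn2.
      - exact: tent_period.
      by move=> i im; apply: (h (Ordinal im)).
    have [j hj] := orbit_meets_leaders t n y (erefl _) t3 yn hh.
    have [d1 d2] := dlt12E t t2; have [d3 d4 _] := dlt_large t (ltnW t3).
    exists j; right; rewrite -/n in d1 d2 d3 d4.
    case: hj => hj; [exists 1 | exists 2 | exists 3 | exists 4] => //; lia.
  (* From [40 * w + 4055 < 7 * n = 40 * delta_5 + 4095] follows [w < delta_5 + 1]. *)
  rewrite negb_forall => /existsP[j]; rewrite -ltnNge => hj.
  by exists j; left; lia.
rewrite t3 in yn *; move: y yn y0.
by apply: (orbit_hits_check 3 (2 ^ 13) 16385%num 2765%num [:: 3277; 2867; 2861; 2771]%num 14);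
  vm_compute.
Qed.

(** * Parameters of the codes *)

Lemma conj2_dbl (l x : nat) (z : 'I_l.+1) : conj2 l.+1 x z -> conj2 l.+1 x (dbl z).
Proof.
move=> xz; apply: conj2_trans xz _; exists 1.
by rewrite /dbl inordK ?ltn_mod // modn_mod expn1 mulnC.
Qed.

Lemma defset0E (l d : nat) : 0 < d -> defset0 l d = ord0 |: defset1 l d.
Proof.
move=> d0; rewrite /defset0 big_ltn //; congr (_ :|: _).
apply/setP=> z; rewrite in_set1; apply/idP/eqP => [/mem_cyc_coset[j] | ->].
  by rewrite mul0n mod0n modn_small // => z0; apply: val_inj.
by apply/mem_cyc_coset; exists 0.
Qed.

Lemma conj2_neq0 (m x z : nat) : 0 < m -> 0 < x < (2 ^ m).+1 ->
  conj2 (2 ^ m).+1 x z -> z != 0.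
Proof.
move=> m0 /andP[x0 xn] /(conj2_sym _ _ _ m0)[j]; apply: contra_eq_neq => ->.
by rewrite mul0n mod0n modn_small // eq_sym -lt0n.
Qed.

Lemma ord0_notin_defset1 (m d : nat) : 0 < m -> d <= (2 ^ m).+1 ->
  ord0 \notin defset1 (2 ^ m) d.
Proof.
move=> m0 dn; apply/negP => /mem_defset1[x [/andP[x0 xd] /conj2_neq0]].
by move=> /(_ m0); rewrite x0 (leq_trans xd dn) => /(_ isT).
Qed.

Lemma subn_of_add (a b c : nat) : a + b = c -> c - a = b.
Proof. by move=> <-; rewrite addKn. Qed.

(** By [cover] the defining set contains [1] to [d - 1], where [d] may exceed [delta]. Negation
    preserves cosets, so together with 0 there are [2 * d - 1] consecutive zeros. *)
Lemma bch_params (F : fieldExtType 'F_2) (xi : F) (m delta d k : nat) :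
  0 < m -> (2 ^ m).+1.-primitive_root%R xi -> 0 < delta <= (2 ^ m).+1 ->
  0 < d <= (2 ^ m).+1 ->
  (forall x, 0 < x < d ->
     exists2 y, 0 < y < delta & conj2 (2 ^ m).+1 y x) ->
  #|defset1 (2 ^ m) delta| + k = 2 ^ m ->
  has_params (cyclic_code xi (defset1 (2 ^ m) delta)) k.+1 d /\
  has_params (cyclic_code xi (defset0 (2 ^ m) delta)) k (2 * d).
Proof.
move=> m0 xi_prim /andP[delta0 delta_n] /andP[d0 dn] cover Tk.
have even_l : ~~ odd (2 ^ m) by rewrite oddX /= orbF -lt0n.
have T1 x : 0 < x < d -> forall z : 'I_(2 ^ m).+1, conj2 (2 ^ m).+1 x z ->
    z \in defset1 (2 ^ m) delta.
  move=> xd z xz; have [y yd yx] := cover x xd.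
  by apply/mem_defset1; exists y; split=> //; apply: conj2_trans yx xz.
split; split.
- rewrite dim_cyclic_code //; first by apply: subn_of_add; rewrite addnS Tk.
  move=> z /mem_defset1[x [xd xz]]; apply/mem_defset1; exists x.
  by split=> //; apply: conj2_dbl.
- move=> c cC c0; apply: (bch_bound F xi (2 ^ m) _ 1 d) cC c0 => // i id.
  apply: (T1 i.+1); first by [].
  by rewrite inordK ?ltn_mod // add1n; exists 0; rewrite muln1 modn_mod.
- rewrite dim_cyclic_code //.
    rewrite defset0E // cardsU1 ord0_notin_defset1 // add1n subSS.
    exact: subn_of_add.
  move=> z /mem_defset0[x [xd xz]]; apply/mem_defset0; exists x.
  by split=> //; apply: conj2_dbl.
move=> c cC c0.
(* The window runs from [- (d - 1)] to [d - 1]; index [d - 1] in it is the residue 0. *)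
apply: (bch_bound F xi (2 ^ m) _ ((2 ^ m).+1 - d).+1 (2 * d)) cC c0 => // i id.
rewrite defset0E // in_setU1.
have [ib|ib] := ltnP i d.-1.
  apply/orP; right; apply: (T1 (d.-1 - i)); first by move: ib; clear; lia.
  apply: (conj2_neg _ _ _ 0); rewrite muln1 inordK ?ltn_mod //.
  rewrite /dvdn modnDmr.
  have -> : d.-1 - i + (((2 ^ m).+1 - d).+1 + i) = (2 ^ m).+1.
    by move: ib dn d0; clear; lia.
  by rewrite modnn.
have -> : ((2 ^ m).+1 - d).+1 + i = (2 ^ m).+1 + (i - d.-1).
  by move: ib dn d0; clear; lia.
have [->|i0] := posnP (i - d.-1).
  by apply/orP; left; rewrite addn0 modnn; apply/eqP/val_inj; rewrite /= inordK.
apply/orP; right; apply: (T1 (i - d.-1)); first by rewrite i0; move: id ib; clear; lia.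
by rewrite modnDl inordK ?ltn_mod //; exists 0; rewrite muln1 modn_mod.
Qed.

Lemma hit_conj2 (t z : nat) : 1 < t -> 0 < z < (2 ^ (4 * t + 2)).+1 ->
  exists v, [/\ 0 < v, v < (2 ^ (4 * t + 2)).+1,
    conj2 (2 ^ (4 * t + 2)).+1 z v & hit t v].
Proof.
move=> t2 /andP[z0 zn].
have on : odd (2 ^ (4 * t + 2)).+1 by rewrite /= addn2 expnS oddM.
have m0 : 0 < 4 * t + 2 by rewrite addn2.
have aux y : 0 < y -> 2 * y <= (2 ^ (4 * t + 2)).+1 ->
    exists v, [/\ 0 < v, v < (2 ^ (4 * t + 2)).+1,
      conj2 (2 ^ (4 * t + 2)).+1 y v & hit t v].
  move=> y0 yn; have [j hj] := orbit_hits t y t2 yn y0.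
  exists (iter j (tent (2 ^ (4 * t + 2)).+1) y); split=> //.
  - exact: iter_tent_gt0.
  - by have := iter_tent_half _ _ j yn; clear; lia.
  exact: conj2_tent.
have [zh|zh] := leqP (2 * z) (2 ^ (4 * t + 2)).+1; first exact: aux.
have [|| v [v0 vn yv vh]] := aux ((2 ^ (4 * t + 2)).+1 - z).
- by rewrite subn_gt0.
- by move: zh; clear; lia.
exists v; split=> //; apply: conj2_trans yv.
by apply: (conj2_neg _ _ _ 0); rewrite muln1 subnKC // ltnW.
Qed.

Lemma dlt_mono (t i k : nat) : 1 < t -> 0 < i -> i <= k -> k <= 5 ->
  dlt t k <= dlt t i.
Proof.
move=> t2 i0; have [e5 e4 e3 e2 e1] := dlt_decr t t2.
have step j : 0 < j < 5 -> dlt t j.+1 <= dlt t j.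
  by case: j => [|[|[|[|[|j]]]]] // _; apply: ltnW.
elim: k => [|k IH]; first by case: i i0.
rewrite leq_eqVlt => /orP[/eqP ->|ik k5] //.
apply: leq_trans (IH ik (ltnW k5)); apply: step.
by rewrite k5 (leq_trans i0).
Qed.

(** The orbit of [x] hits some [delta_k] or a value at most [delta_5]. A hit with [k <= i] would
    make [delta_k] the minimum of the coset of [x], against [x < delta_i]. For [i = 0] there is no
    upper bound. *)
Lemma cover_dlt (t i x : nat) : 1 < t -> i <= 4 -> 0 < x < (2 ^ (4 * t + 2)).+1 ->
  (0 < i -> x < dlt t i) ->
  exists2 y, 0 < y <= dlt t i.+1 & conj2 (2 ^ (4 * t + 2)).+1 y x.
Proof.
move=> t2 i4 xn xi.
have m0 : 0 < 4 * t + 2 by rewrite addn2.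
have [v [v0 vn xv vh]] := hit_conj2 t x t2 xn; exists v; last exact: conj2_sym.
rewrite v0 /=; case: vh => [v5|[k /andP[k0 k4] vk]].
  exact: leq_trans v5 (dlt_mono t i.+1 5 t2 isT i4 isT).
have [ki|ik] := leqP k i; last first.
  by rewrite vk; apply: (dlt_mono t i.+1 k) => //; apply: leq_trans k4 _.
have := leader_min _ _ _ m0 _ _ _ xn => /(_ (dlt t k)) lead.
have xk : dlt t k <= x.
  apply: lead.
  - have [d1 _] := dlt12E t t2; have := dlt_mono t 1 k t2 isT k0 (leqW k4).
    by rewrite -d1; clear; lia.
  - by apply: dlt_leader => //; rewrite k0.
  by rewrite -vk; apply: conj2_sym.
have i0 : 0 < i by apply: leq_trans ki.
have := leq_trans (xi i0) (dlt_mono t k i t2 k0 ki (leqW i4)).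
by rewrite ltnNge xk.
Qed.

Lemma defset1_stable (t i d d' : nat) : 1 < t -> i <= 4 -> dlt t i.+1 < d <= d' ->
  d' <= (2 ^ (4 * t + 2)).+1 -> (0 < i -> d' <= dlt t i) ->
  defset1 (2 ^ (4 * t + 2)) d = defset1 (2 ^ (4 * t + 2)) d'.
Proof.
move=> t2 i4 /andP[id dd'] dn di; apply/setP=> z; apply/idP/idP => /mem_defset1[x [xd xz]].
  apply/mem_defset1; exists x; split=> //.
  by case/andP: xd => -> /leq_trans; apply.
case/andP: xd => x0 xd.
have [||y /andP[y0 yd] yx] := cover_dlt t i x t2 i4.
- by rewrite x0 (leq_trans xd).
- by move=> /di; apply: leq_trans.
apply/mem_defset1; exists y; split; last exact: conj2_trans xz.
by rewrite y0 (leq_ltn_trans yd).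
Qed.

Lemma defset1_leader (t i : nat) : 1 < t -> 0 < i <= 4 ->
  #|defset1 (2 ^ (4 * t + 2)) (dlt t i).+1| =
  #|defset1 (2 ^ (4 * t + 2)) (dlt t i)| + #|cyc_coset (2 ^ (4 * t + 2)) (dlt t i)|.
Proof.
move=> t2 i4; have /andP[i0 i4'] := i4.
have m0 : 0 < 4 * t + 2 by rewrite addn2.
have [e5 _ _ _ _] := dlt_decr t t2.
have d0 : 0 < dlt t i := leq_trans e5 (dlt_mono t i 5 t2 i0 (leqW i4') isT).
have [d1 _] := dlt12E t t2; have := dlt_mono t 1 i t2 isT i0 (leqW i4') => di1.
have dn : 2 * dlt t i <= (2 ^ (4 * t + 2)).+1 by rewrite -d1; move: di1; clear; lia.
rewrite defset1S // cardsU (_ : _ :&: _ = set0) ?cards0 ?subn0 //.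
apply/setP=> z; rewrite in_set0 in_setI; apply/negP.
case/andP=> /mem_defset1[x [/andP[x0 xd] xz]] /mem_cyc_coset dz.
have : dlt t i <= x; last by rewrite leqNgt xd.
apply: (leader_min _ _ _ m0 dn (dlt_leader t i t2 i4)).
  by apply: conj2_trans dz _; apply: conj2_sym.
by rewrite x0; move: xd dn; clear; lia.
Qed.

Lemma card_defset1_all (m : nat) : 0 < m ->
  #|defset1 (2 ^ m) (2 ^ m).+1| = 2 ^ m.
Proof.
move=> m0; rewrite (_ : defset1 _ _ = [set~ ord0]); first by rewrite cardsC1 card_ord.
apply/setP=> z; rewrite in_setC1; apply/idP/idP => [|z0].
  by apply: contraTneq => ->; apply: ord0_notin_defset1.
apply/mem_defset1; exists z; rewrite ltn_ord lt0n; split; last exact: conj2_refl.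
by rewrite andbT; apply: contra z0 => /eqP z0; apply/eqP/val_inj.
Qed.

(** Counted down from the full set of nonzero residues: passing below [delta_1] loses a coset of
    size 4, and below each further leader one of size [2 * m]. *)
Lemma card_defset1_dlt (t i : nat) : 1 < t -> 0 < i <= 4 ->
  #|defset1 (2 ^ (4 * t + 2)) (dlt t i)| + (2 * (4 * t + 2) * (i - 1) + 4) =
  2 ^ (4 * t + 2).
Proof.
move=> t2; have m0 : 0 < 4 * t + 2 by rewrite addn2.
have [d1 _] := dlt12E t t2; have [_ e4 e3 e2 e1] := dlt_decr t t2.
case: i => // i /andP[_]; elim: i => [|i IH] i4.
  have := defset1_leader t 1 t2 isT; rewrite card_dlt1 //.
  rewrite (defset1_stable t 0 _ (2 ^ (4 * t + 2)).+1) //.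
    by rewrite card_defset1_all // subnn muln0 add0n => /esym.
  by rewrite leqnn; move: d1 e1; clear; lia.
have i3 : i.+1 < 4 by [].
apply: etrans (IH (ltnW i3)).
rewrite -(defset1_stable t i.+1 (dlt t i.+2).+1 (dlt t i.+1) t2 (ltnW i3)) //.
- rewrite defset1_leader // card_dlt //.
  by rewrite !subn1 /= mulnS -!addnA; congr (_ + _); rewrite addnA.
- have step j : 0 < j < 5 -> dlt t j.+1 < dlt t j.
    by case: j => [|[|[|[|[|j]]]]] // _; have [? ? ? ? ?] := dlt_decr t t2.
  by rewrite ltnSn; apply: step; apply: ltnW.
by have := dlt_mono t 1 i.+1 t2 isT isT (leqW (ltnW i3)); rewrite -d1; clear; lia.
Qed.

Lemma bad_odd_uniq (H : nat) : 16 <= H -> uniq (bad_odd H).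
Proof.
move=> H16; apply: (sorted_uniq ltn_trans ltnn).
by rewrite /= andbT; do !(apply/andP; split); lia.
Qed.

Lemma bad_odd_odd (h : nat) : 0 < h -> all odd (bad_odd (2 * h)).
Proof.
case: h => // h _; rewrite /= andbT; do !(apply/andP; split); lia.
Qed.

Lemma card_defset1_small (s h delta c : nat) : 4 * h = 2 ^ s -> 8 <= h ->
  delta <= 12 * h + 5 -> count (fun x => x < delta) (bad_odd (2 * h)) = c ->
  #|defset1 (2 ^ (2 * s)) delta| + 4 * s * c = 4 * s * delta./2.
Proof.
move=> hE h8 dh <-.
have HE : 2 * (2 * h) = 2 ^ s by rewrite mulnA.
have H16 : 16 <= 2 * h by rewrite (leq_mul2l 2 8).
have dH : delta <= 6 * (2 * h) + 5 by rewrite mulnA.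
rewrite (card_defset1 s (2 * h) delta HE H16 dH) -mulnDr; congr (_ * _).
apply: sum_odd_notin; first exact: bad_odd_uniq.
by apply: bad_odd_odd; apply: leq_trans h8.
Qed.

Lemma pow_ge (t : nat) : 1 < t -> 3 * (4 * t + 2) <= 2 ^ (2 * t + 1).
Proof.
elim: t => // -[//|[|t]] IH _; first by [].
have := IH isT; rewrite (_ : 2 * t.+3 + 1 = (2 * t.+2 + 1).+2); last by lia.
by rewrite !expnS; move: (2 ^ (2 * t.+2 + 1)) => X; lia.
Qed.

Theorem theorem4p7 (t : nat) (ht : (2 <= t)%N) (delta : nat) (hodd : odd delta)
  (F : fieldExtType 'F_2) (xi : F)
  (hxi : primitive_root_of_unity (2 ^ (4 * t + 2)).+1 xi) :
  let m := (4 * t + 2)%N in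
  let l := (2 ^ m)%N in
  let n := l.+1 in
  let a := (2 ^ (2 * t + 2) + 2 ^ (2 * t + 1))%N in
  (* (1) the code C(n,2,delta,1) *)
  let C1 := cyclic_code xi (defset1 l delta) in
  (* (2) the code C(n,2,delta+1,0) *)
  let C0 := cyclic_code xi (defset0 l delta) in
  ( ((2 ^ (2 * t + 1) + 3 <= delta <= 2 ^ (2 * t + 2) - 5)%N ->
       has_params C1 (n - m * delta + 3 * m) delta)
  /\ ((2 ^ (2 * t + 2) + 5 <= delta <= 2 ^ (2 * t + 2) + 2 ^ (2 * t) - 3)%N ->
       has_params C1 (n - m * delta + 11 * m) delta)
  /\ ((2 ^ (2 * t + 2) + 2 ^ (2 * t) + 3 <= delta <= a - 3)%N ->
       has_params C1 (n - m * delta + 15 * m) delta)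
  /\ ((a - 1 <= delta <= a + 5)%N ->
       has_params C1 (n - m * a + 16 * m) (a + 5))
  /\ (forall i : nat, (1 <= i <= 4)%N ->
       (dlt t i.+1 + 2 <= delta <= dlt t i)%N ->
       has_params C1 (2 * m * (i - 1) + 5) (dlt t i))
  /\ ((dlt t 1 + 2 <= delta <= n)%N -> has_params C1 1 n) )
  /\
  ( ((2 ^ (2 * t + 1) + 3 <= delta <= 2 ^ (2 * t + 2) - 5)%N ->
       has_params C0 (l - m * delta + 3 * m) (2 * delta))
  /\ ((2 ^ (2 * t + 2) + 5 <= delta <= 2 ^ (2 * t + 2) + 2 ^ (2 * t) - 3)%N ->
       has_params C0 (l - m * delta + 11 * m) (2 * delta))
  /\ ((2 ^ (2 * t + 2) + 2 ^ (2 * t) + 3 <= delta <= a - 3)%N ->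
       has_params C0 (l - m * delta + 15 * m) (2 * delta))
  /\ ((a - 1 <= delta <= a + 5)%N ->
       has_params C0 (l - m * a + 16 * m) (2 * (a + 5)))
  /\ (forall i : nat, (1 <= i <= 4)%N ->
       (dlt t i.+1 + 2 <= delta <= dlt t i)%N ->
       has_params C0 (2 * m * (i - 1) + 4) (2 * dlt t i)) ).
Proof.
move=> m l n a C1 C0.
have m0 : 0 < m by rewrite /m addn2.
(* Here [H = 2 ^ (2 * t)]; writing it as [2 * h] shows that [5 * H - 1] and [5 * H + 1] are odd. *)
have [h hE] : exists h, 2 ^ (2 * t) = 2 * h.
  by exists (2 ^ (2 * t).-1); rewrite -expnS prednK // muln_gt0 (ltnW ht).
have sE : 4 * h = 2 ^ (2 * t + 1) by rewrite addn1 expnS hE mulnA.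
have s2E : 8 * h = 2 ^ (2 * t + 2) by rewrite addnS expnS -sE mulnA.
have h8 : 8 <= h.
  by rewrite -(leq_pmul2l (isT : 0 < 2)) -hE -[2 * 8]/(2 ^ 4) leq_exp2l // (leq_mul2l 2 2).
have mE : m = 2 * (2 * t + 1) by rewrite /m; clear; lia.
have aE : a = 12 * h by rewrite /a -sE -s2E; clear; lia.
have lE : l = 16 * (h * h) by rewrite /l mE mulnC expnM -sE -mulnn; clear; lia.
(* This is [m * a <= 2 ^ m]: no subtraction in the dimensions is truncated. *)
have ml : 3 * m * (4 * h) <= l.
  by rewrite lE; have := leq_mul (pow_ge t ht) (leqnn (4 * h)); rewrite -sE -/m; clear; lia.
have hh : 8 * h <= h * h by rewrite leq_mul2r h8 orbT.
(* With [c] bad numbers below [delta], the defining set has [2 * m * (delta./2 - c)] elements; [e]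
   and [k] rewrite this in the stated form. *)
have small_params d e c k : count (fun x => x < delta) (bad_odd (2 * h)) = c ->
   0 < delta <= d -> d <= 12 * h + 5 -> e * m <= l ->
   (forall x, 0 < x < d -> exists2 y, 0 < y < delta & conj2 n y x) ->
   2 * delta./2 + k = e + 2 * c ->
   has_params C1 (n - e * m + k * m) d /\ has_params C0 (l - e * m + k * m) (2 * d).
  move=> cE /andP[d0 dd] d12 el cover ek.
  have cT := card_defset1_small (2 * t + 1) h delta c sE h8 (leq_trans dd d12) cE.
  rewrite -mE -/l in cT.
  have dl : d <= l by apply: leq_trans d12 _; rewrite lE; move: hh h8; clear; lia.
  have -> : n - e * m + k * m = (l - e * m + k * m).+1 by rewrite /n subSn.
  apply: bch_params => //.
  - by rewrite d0 (leq_trans dd) // leqW.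
  - by rewrite (leq_trans d0 dd) leqW.
  rewrite -/l; move: cT el ek; move: #|_| => T cT el ek.
  have : T + m * (2 * c) = m * (2 * delta./2) by rewrite mE; move: cT; clear; lia.
  have : m * (2 * delta./2 + k) = m * (e + 2 * c) by rewrite ek.
  by rewrite !mulnDr; move: el; clear; lia.
have large_params i : 1 <= i <= 4 -> dlt t i.+1 + 2 <= delta <= dlt t i ->
    has_params C1 (2 * m * (i - 1) + 5) (dlt t i) /\
    has_params C0 (2 * m * (i - 1) + 4) (2 * dlt t i).
  move=> i14 /andP[id di]; have /andP[i1 i4] := i14.
  have dn : dlt t i <= n.
    have [d1 _] := dlt12E t ht; rewrite -/m -/l -/n in d1.
    by have := dlt_mono t 1 i ht isT i1 (leqW i4); rewrite -d1; clear; lia.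
  have d0 : 0 < delta by apply: leq_trans id; rewrite addn2.
  have id' : dlt t i.+1 < delta by apply: leq_trans id; rewrite addn2.
  rewrite addnS; apply: bch_params => //.
  - by rewrite d0 (leq_trans di).
  - by rewrite (leq_trans d0).
  - move=> x /andP[x0 xd]; have [||y /andP[y0 yd] yx] := cover_dlt t i x ht i4.
    + by rewrite x0 (leq_trans xd).
    + by [].
    by exists y => //; rewrite y0 (leq_ltn_trans yd).
  apply: etrans (card_defset1_dlt t i ht i14); congr (#|pred_of_set _| + _).
  by apply: (defset1_stable t i) => //; rewrite id' di.
have repetition : dlt t 1 + 2 <= delta <= n -> has_params C1 1 n.
  rewrite addn2 => /andP[d1 dn]; have d1' := ltnW d1.
  have [] // := bch_params F xi m delta n 0 m0 hxi.
  - by rewrite (leq_trans _ d1).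
  - by rewrite leqnn.
  - move=> x xn; have [//|y /andP[y0 yd] yx] := cover_dlt t 0 x ht isT xn.
    by exists y => //; rewrite y0 (leq_ltn_trans yd).
  rewrite addn0; apply: etrans (card_defset1_all m m0); congr #|pred_of_set _|.
  by apply: (defset1_stable t 0) => //; rewrite d1'.
have [k dE] := odd2 delta hodd.
have half_delta : 2 * delta./2 = delta.-1.
  by rewrite -[in RHS](odd_double_half delta) hodd mul2n.
have cnt c : c <= 10 -> all (fun x => x < delta) (take c (bad_odd (2 * h))) ->
    all (fun x => delta <= x) (drop c (bad_odd (2 * h))) ->
    count (fun x => x < delta) (bad_odd (2 * h)) = c.
  move=> c10 h1 h2; rewrite -[bad_odd _](cat_take_drop c) count_cat.
  move: h1; rewrite all_count size_takel // => /eqP ->.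
  rewrite (@eq_in_count _ _ pred0) ?count_pred0 ?addn0 // => x /(allP h2).
  by rewrite leqNgt => /negPf.
(* The values [c = 1, 5, 7] used below give the coefficients 3, 11 and 15. *)
have prefix_params c : count (fun x => x < delta) (bad_odd (2 * h)) = c ->
   delta <= 12 * h ->
   has_params C1 (n - m * delta + (1 + 2 * c) * m) delta /\
   has_params C0 (l - m * delta + (1 + 2 * c) * m) (2 * delta).
  move=> cE d12; rewrite [m * delta]mulnC; apply: small_params cE _ _ _ _ _.
  - by rewrite odd_gt0 /=.
  - by apply: leq_trans d12 _; rewrite leq_addr.
  - by apply: leq_trans ml; have := leq_mul d12 (leqnn m); clear; lia.
  - by move=> x xd; exists x => //; apply: conj2_refl.
  by rewrite half_delta dE; clear; lia.
have range1 : 2 ^ (2 * t + 1) + 3 <= delta <= 2 ^ (2 * t + 2) - 5 ->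
   has_params C1 (n - m * delta + 3 * m) delta /\
   has_params C0 (l - m * delta + 3 * m) (2 * delta).
  rewrite -sE -s2E => dr; apply: (prefix_params 1).
    by apply: cnt => //=; do ?(apply/andP; split) => //; move: dr h8; clear; lia.
  by move: dr; clear; lia.
have range2 : 2 ^ (2 * t + 2) + 5 <= delta <= 2 ^ (2 * t + 2) + 2 ^ (2 * t) - 3 ->
   has_params C1 (n - m * delta + 11 * m) delta /\
   has_params C0 (l - m * delta + 11 * m) (2 * delta).
  rewrite hE -s2E => dr; apply: (prefix_params 5).
    by apply: cnt => //=; do ?(apply/andP; split) => //; move: dr h8; clear; lia.
  by move: dr; clear; lia.
have range3 : 2 ^ (2 * t + 2) + 2 ^ (2 * t) + 3 <= delta <= a - 3 ->
   has_params C1 (n - m * delta + 15 * m) delta /\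
   has_params C0 (l - m * delta + 15 * m) (2 * delta).
  rewrite hE -s2E aE => dr; apply: (prefix_params 7).
    by apply: cnt => //=; do ?(apply/andP; split) => //; move: dr h8; clear; lia.
  by move: dr; clear; lia.
have range4 : a - 1 <= delta <= a + 5 ->
   has_params C1 (n - m * a + 16 * m) (a + 5) /\
   has_params C0 (l - m * a + 16 * m) (2 * (a + 5)).
  rewrite aE [m * (12 * h)]mulnC => dr.
  (* Of the last three bad numbers, which surround [a = 6 * H], exactly [j] lie below [delta]. *)
  have [j [j3 jE]] : exists j, j < 4 /\ delta + 1 = 12 * h + 2 * j.
    by exists (k + 1 - 6 * h); move: dE dr h8; clear; lia.
  apply: (small_params _ _ (7 + j)).
  - apply: cnt; first by rewrite (leq_add2l 7 _ 3).
      by case: j j3 jE => [|[|[|[|j]]]] //= _; do ?(apply/andP; split) => //;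
        move: h8; clear; lia.
    by case: j j3 jE => [|[|[|[|j]]]] //= _; do ?(apply/andP; split) => //;
        move: h8; clear; lia.
  - by rewrite odd_gt0 //=; case/andP: dr.
  - by [].
  - by apply: leq_trans ml; clear; lia.
  (* Every [x] from [delta] to [a + 4] is even or bad, so it descends to a conjugate below [delta];
     hence the distance [a + 5] on the whole range. *)
  - elim/ltn_ind => x IH /andP[x0 x5].
    have [xd|dx] := ltnP x delta; first by exists x; [rewrite x0 | apply: conj2_refl].
    have xbad : ~~ is_good (2 * h) x.
      apply/negP => /andP[/odd2[kx xE] xb]; move: xb.
      by rewrite !inE !negb_or; move: dr dx x5 xE h8; clear; lia.
    have [||y /andP[y0 yx] yxc] := nongood_conj2 (2 * t + 1) (2 * h) x _ _ x0 xbad.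
    + by rewrite mulnA.
    + by rewrite (leq_mul2l 2 8).
    have [|z zd zy] := IH y yx; first by rewrite y0 (ltn_trans yx).
    by exists z => //; apply: conj2_trans zy _; rewrite /n /l mE.
  by rewrite half_delta; move: jE dE; clear; lia.
split.
- split; first by case/range1.
  split; first by case/range2.
  split; first by case/range3.
  split; first by case/range4.
  by split=> [i i14 /(large_params i i14)[]|].
split; first by case/range1.
split; first by case/range2.
split; first by case/range3.
split; first by case/range4.
by move=> i i14 /(large_params i i14)[].
Qed.
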